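(* Let $B\subset\mathbb R^8$ be a bounded domain with $C^3$ boundary and let $(B^h)_{h>0}$, $B^h\subset\mathbb Z^8_h$, satisfy $B=B^h+O(h^2)$. Then for every $f\in C^3(\overline B,\mathbb O)$ with $Df=0$ in $B$ there exist functions $f^h:B^h\to\mathbb O$ ($h>0$) such that $D^hf^h(x)=0$ for every $x\in(B^h)^\circ$ and $$\lim_{h\to0^+}\ \max_{x\in B^h\cap B}|f(x)-f^h(x)|=0.$$
   Context: $\mathbb O$ is the real octonion algebra with basis $\mathbf e_0=1,\dots,\mathbf e_7$, identified with $\mathbb R^8$; $|\cdot|$ is the Euclidean norm. $Df=\sum_{l=0}^7\mathbf e_l\,\partial f/\partial x_l$. For $h>0$, $\mathbb Z^8_h=(h\mathbb Z)^8$, $e_0,\dots,e_7$ are the standard unit vectors, $D^hf(x)=\sum_{l=0}^7\mathbf e_l\frac{f(x+he_l)-f(x-he_l)}{2h}$. For $A\subset\mathbb Z^8_h$: $N(x)=\{x,x\pm he_0,\dots,x\pm he_7\}$, $\partial A=\{x\in\mathbb Z^8_h:\ N(x)\cap A\neq\emptyset,\ N(x)\cap(\mathbb Z^8_h\setminus A)\neq\emptyset\}$, $A^\circ=A\setminus\partial A$. A family $(B^h)_{h>0}$ with $B^h\subset\mathbb Z^8_h$ converges to a bounded domain $B\subset\mathbb R^8$ if, as $h\to0^+$, $\max_{\alpha\in\partial B}\min_{\beta\in\partial B^h}\|\alpha-\beta\|\to0$, $\max_{\alpha\in\partial B^h}\min_{\beta\in\partial B}\|\alpha-\beta\|\to0$,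 $\max_{\alpha\in\overline B}\min_{\beta\in B^h}\|\alpha-\beta\|\to0$, and $\max_{\alpha\in B^h}\min_{\beta\in\overline B}\|\alpha-\beta\|\to0$ (topological $\partial B,\overline B$ in $\mathbb R^8$; discrete $\partial B^h$). We write $B=B^h+O(h^2)$ if $(B^h)$ converges to $B$ and in addition $h^8\,\#(B^h\setminus B)=O(h^2)$ as $h\to0^+$. *)

(* Defs.v *)
From HB Require Import structures.
From mathcomp Require Import all_boot all_order all_algebra.
From mathcomp Require Import all_classical all_reals all_analysis.
Set Implicit Arguments. Unset Strict Implicit. Unset Printing Implicit Defensive.
Import Order.TTheory GRing.Theory Num.Theory.
Import numFieldNormedType.Exports.
Local Open Scope classical_set_scope.
Local Open Scope ring_scope.

Section Defs.
Variable R : realType.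

Definition evec {n} (l : 'I_n) : 'rV[R]_n := delta_mx 0 l.

Definition enorm {n} (x : 'rV[R]_n) : R := Num.sqrt (\sum_i (x 0 i) ^+ 2).

(* Octonion multiplication (Cayley-Dickson / standard Fano-plane table):
   e_a e_b = e_c for the cyclic triples below, e_b e_a = - e_c,
   e_i e_i = -1 (i >= 1), e_0 = 1. *)
Definition oct_triples : seq (nat * nat * nat) :=
  [:: (1,2,3); (1,4,5); (1,7,6); (2,4,6); (2,5,7); (3,4,7); (3,6,5)]%N.

Definition oct_pos (i j k : nat) : bool :=
  has (fun t : nat * nat * nat => let: (a, b, c) := t in
         [|| (i, j, k) == (a, b, c), (i, j, k) == (b, c, a) | (i, j, k) == (c, a, b)])
      oct_triples.

Definition oct_coef (i j k : nat) : R :=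
  if i == 0%N then (j == k)%:R
  else if j == 0%N then (i == k)%:R
  else if i == j then - (k == 0%N)%:R
  else if oct_pos i j k then 1
  else if oct_pos j i k then -1
  else 0.

Definition omul (x y : 'rV[R]_8) : 'rV[R]_8 :=
  \row_(k < 8) \sum_(i < 8) \sum_(j < 8) x 0 i * y 0 j * oct_coef i j k.

Definition pd {n} {V : normedModType R} (l : 'I_n) (g : 'rV[R]_n -> V)
  : 'rV[R]_n -> V := fun x => 'D_(evec l) g x.

Definition iter_pd {n} {V : normedModType R} (s : seq 'I_n) (g : 'rV[R]_n -> V)
  : 'rV[R]_n -> V := foldr (@pd n V) g s.

Definition Ck_open {n} {V : normedModType R} (k : nat) (U : set 'rV[R]_n)
  (g : 'rV[R]_n -> V) : Prop :=
  forall s : seq 'I_n, (size s <= k)%N ->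
    (forall x, U x -> {for x, continuous (iter_pd s g)}) /\
    ((size s < k)%N -> forall (l : 'I_n) x, U x -> derivable (iter_pd s g) x (evec l)).

Definition Ck_closure {n} {V : normedModType R} (k : nat) (B : set 'rV[R]_n)
  (g : 'rV[R]_n -> V) : Prop :=
  Ck_open k B g /\ {within closure B, continuous g} /\
  forall s : seq 'I_n, (size s <= k)%N ->
    exists G : 'rV[R]_n -> V, {within closure B, continuous G} /\
      forall x, B x -> G x = iter_pd s g x.

Definition tbd {n} (B : set 'rV[R]_n) : set 'rV[R]_n := closure B `\` interior B.

Definition bounded_domain {n} (B : set 'rV[R]_n) : Prop :=
  B !=set0 /\ open B /\ connected B /\ bounded_set B.

Definition C3_boundary (B : set 'rV[R]_8) : Prop :=
  forall p, tbd B p ->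
    exists (r : R) (Q : 'M[R]_8) (phi : 'rV[R]_7 -> R),
      0 < r /\ Q *m Q^T = 1%:M /\ Ck_open 3 setT phi /\
      forall x, enorm (x - p) < r ->
        (B x <-> let y := (x - p) *m Q in
                 y 0 ord_max < phi (\row_(i < 7) y 0 (widen_ord (leqnSn 7) i))).

Definition Dirac (f : 'rV[R]_8 -> 'rV[R]_8) (x : 'rV[R]_8) : 'rV[R]_8 :=
  \sum_(l < 8) omul (evec l) (pd l f x).

Definition emb (h : R) (k : 'rV[int]_8) : 'rV[R]_8 :=
  h *: map_mx (fun z : int => z%:~R) k.

Definition ivec (l : 'I_8) : 'rV[int]_8 := delta_mx 0 l.

Definition nbr (k m : 'rV[int]_8) : Prop :=
  m = k \/ exists l, m = k + ivec l \/ m = k - ivec l.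

(* discrete boundary and interior of A subset of Z^8 (scaling by h is
   irrelevant to these combinatorial notions) *)
Definition dbd (A : set 'rV[int]_8) : set 'rV[int]_8 :=
  [set k | (exists m, nbr k m /\ A m) /\ (exists m, nbr k m /\ ~ A m)].
Definition dint (A : set 'rV[int]_8) : set 'rV[int]_8 := A `\` dbd A.

(* discrete Dirac operator D^h on g : (hZ)^8 -> O, in integer coordinates *)
Definition Dh (h : R) (g : 'rV[int]_8 -> 'rV[R]_8) (k : 'rV[int]_8) : 'rV[R]_8 :=
  \sum_(l < 8) omul (evec l) ((2 * h)^-1 *: (g (k + ivec l) - g (k - ivec l))).

(* (B^h) converges to B (Hausdorff-type conditions, written as max-min <= eps) *)
Definition lattice_converges (Bh : R -> set 'rV[int]_8) (B : set 'rV[R]_8) : Prop :=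
  forall eps : R, 0 < eps -> exists h0 : R, 0 < h0 /\ forall h, 0 < h -> h < h0 ->
    (forall a, tbd B a -> exists k, dbd (Bh h) k /\ enorm (a - emb h k) <= eps) /\
    (forall k, dbd (Bh h) k -> exists a, tbd B a /\ enorm (emb h k - a) <= eps) /\
    (forall a, closure B a -> exists k, Bh h k /\ enorm (a - emb h k) <= eps) /\
    (forall k, Bh h k -> exists a, closure B a /\ enorm (emb h k - a) <= eps).

Definition approx_O_h2 (Bh : R -> set 'rV[int]_8) (B : set 'rV[R]_8) : Prop :=
  lattice_converges Bh B /\
  exists (C h0 : R), 0 < h0 /\ forall h, 0 < h -> h < h0 ->
    exists s : seq 'rV[int]_8,
      (forall k, Bh h k -> ~ B (emb h k) -> k \in s) /\
      h ^+ 8 * (size s)%:R <= C * h ^+ 2.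

End Defs.

(* Main.v *)
Require Import Defs.
From HB Require Import structures.
From mathcomp Require Import all_boot all_order all_algebra.
From mathcomp Require Import all_classical all_reals all_analysis.
From mathcomp Require Import ring lra zify.
Import Order.TTheory GRing.Theory Num.Theory.
Import numFieldNormedType.Exports.
Local Open Scope classical_set_scope.
Local Open Scope ring_scope.

Set Implicit Arguments. Unset Strict Implicit. Unset Printing Implicit Defensive.

(* On a lattice box of physical size O(1), D^h has a right inverse which is
   bounded in the sup norm uniformly in h: by the Clifford relations
   e_l (conj e_m x) + e_m (conj e_l x) = 2 delta_lm x, the operator D^h composed
   with its conjugate is the Laplacian with step 2h, so u = conj(D^h) w with w a
   solution of a Poisson equation, and the first differences of w are bounded by
   Brandt's maximum-principle argument.  Hence it suffices to find, for every
   eps, a function G defined near the closure of B with |G - f| <= eps on B and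
   |D^h G| <= eps at all points near the closure of B, for all small h.  Near a
   point p of the closure, f (x - t v_p) is such a function, where v_p is an
   outward direction (the boundary is locally a graph; v_p = 0 inside B); these
   pieces are glued by a Lipschitz partition of unity, and the error is controlled
   by the modulus of continuity of f. *)

(** * Discrete potential theory *)

Section DiscretePotentialTheory.
Variable R : realType.
Local Notation lattice := 'rV[int]_8.
Implicit Types (k m : lattice) (v w g : lattice -> R).

Definition box (M : nat) : set lattice := [set k | forall i, `|k 0 i| <= M%:Z].

(* Step 2, because the discrete Dirac operator uses central differences. *)
Definition lap2 v k : R :=
  \sum_(l < 8) (v (k + ivec l + ivec l) + v (k - ivec l - ivec l) - v k *+ 2).

Definition nbr2 k m : Prop :=
  exists l, m = k + ivec l + ivec l \/ m = k - ivec l - ivec l.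

Lemma addivE k (l i : 'I_8) : (k + ivec l) 0 i = if i == l then k 0 i + 1 else k 0 i.
Proof. by rewrite !mxE /=; case: eqP => _ /=; rewrite ?addr0. Qed.

Lemma subivE k (l i : 'I_8) : (k - ivec l) 0 i = if i == l then k 0 i - 1 else k 0 i.
Proof. by rewrite !mxE /=; case: eqP => _ /=; rewrite ?subr0. Qed.

Definition ivE := (addivE, subivE).

Lemma box_nbr2 M k m : box M k -> nbr2 k m -> box (M + 2) m.
Proof.
move=> bk [l [->|->]] i; move: (bk i); rewrite !ivE; case: (i == l); lia.
Qed.

Lemma box_le M N k : (M <= N)%N -> box M k -> box N k.
Proof. by move=> MN bk i; move: (bk i); lia. Qed.

Lemma box_finite (M : nat) : exists s : seq lattice, forall k, box M k -> k \in s.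
Proof.
exists [seq (\row_i ((x 0 i : nat)%:Z - M%:Z)) | x : 'rV['I_(M + M).+1]_8] => k bk.
apply/mapP; exists (\row_i inord (absz (k 0 i + M%:Z))); first by rewrite mem_enum.
have key (c : int) : `|c| <= M%:Z ->
    (absz (c + M%:Z)%R < (M + M).+1)%N /\ c = (absz (c + M%:Z))%:Z - M%:Z by lia.
by apply/rowP => i; have [h1 h2] := key _ (bk i); rewrite !mxE inordK.
Qed.

Lemma seq_argmax (T : eqType) (P : T -> Prop) (v : T -> R) (s : seq T) :
  (exists2 x, x \in s & P x) ->
  exists2 x, P x & forall y, y \in s -> P y -> v y <= v x.
Proof.
elim: s => [[x] //|a s IH [x xas Px]].
have [[y ys Py]|nP] := pselect (exists2 y, y \in s & P y); last first.
  exists x => // y; rewrite inE => /orP[/eqP -> Pa|ys Py]; last by case: nP; exists y.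
  move: xas; rewrite inE => /orP[/eqP -> //|xs]; by case: nP; exists x.
have [z Pz zmax] : exists2 z, P z & forall y, y \in s -> P y -> v y <= v z.
  by apply: IH; exists y.
have [[Pa az]|na] := pselect (P a /\ v z <= v a).
  exists a => // t; rewrite inE => /orP[/eqP -> //|ts Pt].
  exact: le_trans (zmax _ ts Pt) az.
exists z => // t; rewrite inE => /orP[/eqP -> Pa|ts Pt]; last exact: zmax.
by have [//|/ltW za] := leP (v a) (v z); case: na.
Qed.

(** At a positive maximum over the finite set [Q] no neighbour has a larger value, being nonpositive
    or again in [Q], so [lap2 v] cannot be positive there. The closure condition on [Q] replaces
    boundary values. *)
Lemma max_principle v (Q : set lattice) (M : nat) :
  (forall k, Q k -> box M k) ->
  (forall k, Q k -> 0 < v k -> 0 < lap2 v k) ->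
  (forall k m, Q k -> 0 < v k -> nbr2 k m -> 0 < v m -> Q m) ->
  forall k, Q k -> v k <= 0.
Proof.
move=> Qb Ql Qn k0 Qk0; have [//|v0] := leP (v k0) 0.
have [s sP] := box_finite M.
have [k Qk kmax] : exists2 k, Q k & forall m, m \in s -> Q m -> v m <= v k.
  by apply: seq_argmax; exists k0 => //; apply: sP; apply: Qb.
have vk : 0 < v k by apply: lt_le_trans v0 (kmax _ _ Qk0); apply: sP; apply: Qb.
have vn m : nbr2 k m -> v m <= v k.
  move=> km; have [vm|/le_trans] := ltP 0 (v m); last by apply; exact: ltW.
  have Qm := Qn _ _ Qk vk km vm; by apply: kmax => //; apply/sP/Qb.
have := Ql _ Qk vk; rewrite ltNge /lap2 sumr_le0 // => l _.
have h1 : v (k + ivec l + ivec l) <= v k by apply: vn; exists l; left.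
have h2 : v (k - ivec l - ivec l) <= v k by apply: vn; exists l; right.
lra.
Qed.

Lemma lap2D v w k : lap2 (fun x => v x + w x) k = lap2 v k + lap2 w k.
Proof. by rewrite /lap2 -big_split /=; apply: eq_bigr => l _; ring. Qed.

Lemma lap2Z (c : R) v k : lap2 (fun x => c * v x) k = c * lap2 v k.
Proof. by rewrite /lap2 mulr_sumr; apply: eq_bigr => l _; ring. Qed.

Lemma lap2_cst (c : R) k : lap2 (fun=> c) k = 0.
Proof. by rewrite /lap2 big1 // => l _; ring. Qed.

Lemma lap2_sum I (r : seq I) (F : I -> lattice -> R) k :
  lap2 (fun x => \sum_(i <- r) F i x) k = \sum_(i <- r) lap2 (F i) k.
Proof.
elim: r => [|i r IH]; first by rewrite big_nil -[RHS](lap2_cst 0 k) /lap2;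
  apply: eq_bigr => l _; rewrite !big_nil.
rewrite big_cons -IH -lap2D /lap2; apply: eq_bigr => l _; by rewrite !big_cons.
Qed.

Lemma lap2_coord (c : int) (l : 'I_8) k : lap2 (fun x => (x 0 l - c)%:~R) k = 0.
Proof.
rewrite /lap2 big1 // => i _; rewrite !ivE; case: (l == i); ring.
Qed.

Lemma lap2_coord_sq (c : int) (l : 'I_8) k :
  lap2 (fun x => (x 0 l - c)%:~R ^+ 2) k = 8.
Proof.
rewrite /lap2 (bigD1 l) //= big1 => [|i /negPf il].
  by rewrite !ivE eqxx; ring.
by rewrite !ivE eq_sym il; ring.
Qed.

Definition sqn k : R := \sum_(i < 8) (k 0 i)%:~R ^+ 2.

Lemma lap2_sqn k : lap2 sqn k = 64.
Proof.
rewrite /sqn lap2_sum (eq_bigr (fun=> 8)).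
  by rewrite sumr_const card_ord; ring.
move=> i _; rewrite -(lap2_coord_sq 0 i k) /lap2; apply: eq_bigr => l _.
by rewrite !subr0.
Qed.

Lemma sqn_ge0 k : 0 <= sqn k.
Proof. by apply: sumr_ge0 => i _; exact: sqr_ge0. Qed.

Lemma sqn_box M k : box M k -> sqn k <= 8 * M%:R ^+ 2.
Proof.
move=> bk; apply: (@le_trans _ _ (\sum_(i < 8) M%:R ^+ 2)).
  apply: ler_sum => i _; rewrite -real_normK ?num_real // lerXn2r ?nnegrE //.
  by rewrite -intr_norm pmulrn ler_int bk.
by rewrite sumr_const card_ord; lra.
Qed.

(** * Poisson's equation with step 2 on a box *)

Section Poisson.
Variables (M : nat) (g : lattice -> R).
Hypothesis g64 : forall k, box M k -> `|g k| <= 64.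

(* Jacobi iteration for [lap2 w = g] on the box, frozen outside of it. *)
Definition jacobi v k : R :=
  if `[< box M k >] then
    (\sum_(l < 8) (v (k + ivec l + ivec l) + v (k - ivec l - ivec l)) - g k) / 16
  else sqn k.

Definition jacobi_seq k (n : nat) : R := iter n jacobi sqn k.

Lemma sum_nbr2 v k :
  \sum_(l < 8) (v (k + ivec l + ivec l) + v (k - ivec l - ivec l)) =
  lap2 v k + 16 * v k.
Proof.
rewrite /lap2 [in RHS]sumrB sumr_const card_ord; ring.
Qed.

Lemma jacobi_mono v w : (forall k, v k <= w k) -> forall k, jacobi v k <= jacobi w k.
Proof.
move=> vw k; rewrite /jacobi; case: asboolP => // _.
by rewrite ler_pM2r ?invr_gt0 // lerD2r; apply: ler_sum => l _; exact: lerD.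
Qed.

(* [sqn] is a subsolution. *)
Lemma jacobi_seq_step n k : jacobi_seq k n <= jacobi_seq k n.+1.
Proof.
rewrite /jacobi_seq; elim: n k => [|n IH] k; last exact: jacobi_mono.
rewrite /= /jacobi; case: asboolP => // bk.
rewrite sum_nbr2 lap2_sqn; have := g64 bk; rewrite ler_norml => /andP[_ ?]; lra.
Qed.

(** Twice the maximal size of [sqn] on [box (M + 2)], so that [sqn <= U - sqn] there. *)
Let U : R := 16 * (M + 2)%:R ^+ 2.

(* [U - sqn] is a supersolution. *)
Lemma jacobi_seq_ub n k : box (M + 2) k -> jacobi_seq k n <= U - sqn k.
Proof.
rewrite /jacobi_seq; elim: n k => [|n IH] k bk.
  by have := sqn_box bk; rewrite /U /=; lra.
rewrite /= /jacobi; case: asboolP => [Mk|_]; last by have := sqn_box bk; rewrite /U; lra.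
have le1 : \sum_(l < 8) (iter n jacobi sqn (k + ivec l + ivec l)
    + iter n jacobi sqn (k - ivec l - ivec l))
    <= \sum_(l < 8) ((U - sqn (k + ivec l + ivec l)) + (U - sqn (k - ivec l - ivec l))).
  apply: ler_sum => l _; apply: lerD; apply: IH; apply: (box_nbr2 Mk); exists l;
  by [left|right].
have eq1 : lap2 (fun x => U - sqn x) k = - 64.
  have -> : lap2 (fun x => U - sqn x) k = lap2 (fun x => U + -1 * sqn x) k.
    by apply: eq_bigr => l _; ring.
  by rewrite lap2D lap2_cst lap2Z lap2_sqn; ring.
rewrite (sum_nbr2 (fun x => U - sqn x)) eq1 in le1.
have := g64 Mk; rewrite ler_norml => /andP[? _]; lra.
Qed.

Lemma jacobi_seq_lb n k : sqn k <= jacobi_seq k n.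
Proof.
elim: n => [//|n IH]; exact: le_trans IH (jacobi_seq_step n k).
Qed.

Lemma jacobi_seq_nondec k : nondecreasing_seq (jacobi_seq k).
Proof. by apply/nondecreasing_seqP => n; exact: jacobi_seq_step. Qed.

Lemma jacobi_seq_cvg k : cvgn (jacobi_seq k).
Proof.
apply: nondecreasing_is_cvgn; first exact: jacobi_seq_nondec.
have [bk|nbk] := pselect (box (M + 2) k).
  by exists (U - sqn k) => _ [n _ <-]; exact: jacobi_seq_ub.
(* Outside [box M] the iteration keeps the initial value [sqn k]. *)
exists (sqn k) => _ [n _ <-]; case: n => [|n] //=.
rewrite /jacobi_seq /= /jacobi; case: asboolP => // bk.
by case: nbk; apply: box_le bk; exact: leq_addr.
Qed.

(** The iterates increase from [sqn] and stay below [U - sqn], hence converge, and the limit is a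
    fixed point. The bound 64 on [g] is the constant value of [lap2 sqn]. *)
Lemma poisson_box : exists w : lattice -> R,
  (forall k, box M k -> lap2 w k = g k) /\
  (forall k, box (M + 2) k -> 0 <= w k <= U).
Proof.
exists (fun k => limn (jacobi_seq k)); split=> k bk; last first.
  apply/andP; split.
    apply: limr_ge; first exact: jacobi_seq_cvg.
    by near=> n; apply: le_trans (sqn_ge0 k) (jacobi_seq_lb n k).
  apply: limr_le; first exact: jacobi_seq_cvg.
  near=> n; have := jacobi_seq_ub n bk; have := sqn_ge0 k; lra.
set w := fun k => limn (jacobi_seq k).
have cw x : jacobi_seq x @ \oo --> w x by exact: jacobi_seq_cvg.
have c1 : (fun n => jacobi_seq k n.+1) @ \oo -->
    (\sum_(l < 8) (w (k + ivec l + ivec l) + w (k - ivec l - ivec l)) - g k) / 16.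
  have -> : (fun n => jacobi_seq k n.+1) = (fun n => (\sum_(l < 8)
     (jacobi_seq (k + ivec l + ivec l) n + jacobi_seq (k - ivec l - ivec l) n) - g k) / 16).
    by apply/funext => n; rewrite /jacobi_seq /= {1}/jacobi asboolT.
  apply: cvgMl; apply: cvgB; last exact: cvg_cst.
  by apply: cvg_big => [|l _]; [exact: add_continuous|exact: cvgD].
have /(cvg_lim (@Rhausdorff R)) e1 := c1.
have /(cvg_lim (@Rhausdorff R)) e2 : (fun n => jacobi_seq k n.+1) @ \oo --> w k.
  by rewrite cvg_shiftS; exact: cw.
move: e1; rewrite e2 sum_nbr2 => e1; lra.
Unshelve. all: by end_near.
Qed.

End Poisson.
End DiscretePotentialTheory.

(** * Interior gradient estimate for Poisson's equation *)

Section InteriorGradientBound.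
Variable R : realType.
Local Notation lattice := 'rV[int]_8.
Implicit Types (k m : lattice) (v w g : lattice -> R).

Definition reflect_at (l : 'I_8) (c : int) k : lattice :=
  \row_i (if i == l then 2 * c - k 0 i else k 0 i).

Lemma reflect_atE l c k i :
  reflect_at l c k 0 i = if i == l then 2 * c - k 0 i else k 0 i.
Proof. by rewrite mxE. Qed.

Lemma reflect_at_addiv l c k i : reflect_at l c (k + ivec i) =
  if i == l then reflect_at l c k - ivec i else reflect_at l c k + ivec i.
Proof.
apply/rowP => j; case: (eqVneq i l) => [->|/negPf il];
  rewrite !(ivE, reflect_atE); case: (eqVneq j l) => [->|/negPf jl] //.
- ring.
- by rewrite eq_sym il.
Qed.

Lemma reflect_at_subiv l c k i : reflect_at l c (k - ivec i) =
  if i == l then reflect_at l c k + ivec i else reflect_at l c k - ivec i.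
Proof.
apply/rowP => j; case: (eqVneq i l) => [->|/negPf il];
  rewrite !(ivE, reflect_atE); case: (eqVneq j l) => [->|/negPf jl] //.
- ring.
- by rewrite eq_sym il.
Qed.

Lemma lap2_reflect l c w k :
  lap2 (fun x => w (reflect_at l c x)) k = lap2 w (reflect_at l c k).
Proof.
apply: eq_bigr => i _; rewrite !(reflect_at_addiv, reflect_at_subiv).
by case: (i == l) => //; rewrite [X in X - _]addrC.
Qed.

Lemma reflect_at_fix l c k : k 0 l = c -> reflect_at l c k = k.
Proof.
by move=> kl; apply/rowP => i; rewrite reflect_atE; case: eqVneq => [->|//]; lia.
Qed.

(** Since [lap2] has step 2, a neighbour may jump over the mirror, but only from offset 1 to -1,
    landing on the mirror image. *)
Lemma reflect_at_near l c k m : nbr2 k m -> 0 < k 0 l - c -> m 0 l - c = -1 ->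
  k 0 l - c = 1 /\ m = reflect_at l c k.
Proof.
move=> [j [] ->]; rewrite !ivE; case: (eqVneq l j) => [<-|lj]; try lia.
move=> kl ml; split; first by lia.
apply/rowP => i; rewrite reflect_atE !ivE; case: (eqVneq i l) => // ->; lia.
Qed.

Lemma nbr2_coord k m : nbr2 k m -> forall i, `|m 0 i - k 0 i| <= 2.
Proof. by move=> [j [] ->] i; rewrite !ivE; case: (i == j); lia. Qed.

Section Barrier.
Variables (N : nat) (l : 'I_8) (k0 : lattice).

(* [256 * N ^ 2] is the bound for the solution of [poisson_box].  The coefficients
   make [barrier] strictly superharmonic and at least that bound when the distance
   to the mirror or a transversal coordinate exceeds [N]; the additive constant
   keeps the sum of the values at distances 1 and -1 nonnegative. *)
Definition barrier k : R :=
  \sum_i (if i == l then -1793 else 256) * (k 0 i - k0 0 i)%:~R ^+ 2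
  + (5635 * N%:R * (k 0 l - k0 0 l)%:~R + 1793).

(** Each squared coordinate contributes 8 times its coefficient, and [7 * 256 - 1793 = -1]. *)
Lemma lap2_barrier k : lap2 barrier k = - 8.
Proof.
rewrite /barrier lap2D lap2D lap2_cst lap2Z lap2_coord lap2_sum.
rewrite (eq_bigr (fun i => (if i == l then -1793 else 256) * 8)); last first.
  by move=> i _; rewrite lap2Z lap2_coord_sq.
rewrite (bigD1 l) //= eqxx (eq_bigr (fun=> 256 * 8)); last by move=> i /negPf ->.
by rewrite sumr_const cardC1 card_ord /=; ring.
Qed.

Definition transversal k : R := \sum_(i | i != l) 256 * (k 0 i - k0 0 i)%:~R ^+ 2.

Lemma transversal_ge0 k : 0 <= transversal k.
Proof. by apply: sumr_ge0 => i _; rewrite mulr_ge0 ?ler0n ?sqr_ge0. Qed.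

Lemma transversal_ge k i :
  i != l -> 256 * (k 0 i - k0 0 i)%:~R ^+ 2 <= transversal k.
Proof.
move=> il; rewrite /transversal (bigD1 i) //= lerDl.
by apply: sumr_ge0 => j _; rewrite mulr_ge0 ?ler0n ?sqr_ge0.
Qed.

Lemma barrierE k (y : R) : y = (k 0 l - k0 0 l)%:~R ->
  barrier k = transversal k + (5635 * N%:R * y - 1793 * y ^+ 2 + 1793).
Proof.
move=> ->; rewrite /barrier (bigD1 l) //= eqxx.
rewrite (eq_bigr (fun i => 256 * (k 0 i - k0 0 i)%:~R ^+ 2)); last by move=> i /negPf ->.
by rewrite -/(transversal k); ring.
Qed.

End Barrier.

(* Brandt's argument: the odd part of [w] under the reflection about [k0]
   vanishes on the mirror, so a quadratic barrier which is linear near the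
   mirror dominates it. *)
Lemma gradient_ub (N : nat) w g l k0 : (0 < N)%N ->
  (forall k, box (2 * N) k -> lap2 w k = g k) ->
  (forall k, box (2 * N) k -> `|g k| <= 1) ->
  (forall k, box (2 * N + 2) k -> 0 <= w k <= 256 * N%:R ^+ 2) ->
  box N k0 -> w (k0 + ivec l) - w (k0 - ivec l) <= 5635 * N%:R.
Proof.
move=> N0 Lw g1 wb bk0; pose c := k0 0 l; pose rho := reflect_at l c.
pose v k := w k - w (rho k) - barrier N l k0 k.
(* Half of the box of radius [N] about [k0]. As [k0] is in [box N], this half and its reflection
   stay in [box (2 * N)], where the equation holds. *)
pose Q : set lattice := [set k | 0 < k 0 l - c <= N%:Z /\
  forall i, i != l -> `|k 0 i - k0 0 i| <= N%:Z].
have N1 : 1 <= N%:R :> R by rewrite ler1n.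
have QM k : Q k -> box (2 * N) k /\ box (2 * N) (rho k).
  move=> [kl ki]; split=> i; move: (bk0 i); rewrite ?reflect_atE;
    case: (eqVneq i l) => [->|/ki]; move: kl; rewrite /c;
    move: (k0 0 i) (k0 0 l) (k 0 i) (k 0 l) => ? ? ? ?; clear; lia.
(* The two values of [g] contribute at least -2, the barrier 8. *)
have Lv k : Q k -> 0 < lap2 v k.
  move=> Qk; have [b1 b2] := QM _ Qk.
  have -> : lap2 v k = lap2 (fun x => w x + (-1 * w (rho x) + -1 * barrier N l k0 x)) k.
    by apply: eq_bigr => i _; rewrite /v; ring.
  rewrite !lap2D !lap2Z lap2_barrier lap2_reflect -/(rho k) !Lw //.
  have := g1 _ b1; have := g1 _ b2; rewrite !ler_norml => /andP[_ ?] /andP[? _]; lra.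
have vQ k : Q k -> v k <= 0.
  apply: (@max_principle R v Q (2 * N)) => [{}k /QM[]//|{}k Qk _|{}k m Qk vk km vm].
    exact: Lv.
  have [b1 b2] := QM _ Qk.
  have bm : box (2 * N + 2) m := box_nbr2 b1 km.
  have brm : box (2 * N + 2) (rho m).
    apply: (box_nbr2 b2); case: km => i [] ->; exists i;
    rewrite /rho !(reflect_at_addiv, reflect_at_subiv); case: (i == l); by [left|right].
  have phi_le : w m - w (rho m) <= 256 * N%:R ^+ 2.
    have /andP[? ?] := wb _ bm; have /andP[? ?] := wb _ brm; lra.
  case: (Qk) => kl ki.
  have ml : m 0 l - c >= -1 /\ m 0 l - c <= N%:Z + 2.
    move: kl (nbr2_coord km l); move: (m 0 l) (k 0 l) => ? ?; clear; lia.
  set y : R := (m 0 l - c)%:~R.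
  have vmE := @barrierE N l k0 m y erefl.
  have t0 := transversal_ge0 l k0 m.
  (* On the mirror only minus the barrier remains. At offset -1, [m] is the reflection of [k], and
     [v m + v k] is minus the sum of the two barrier values, hence nonpositive; so [v m] and [v k]
     are not both positive. *)
  have [ypos|yneg] := ltP 0 (m 0 l - c); last first.
    have [y0|ym1] : m 0 l - c = 0 \/ m 0 l - c = -1.
      move: yneg (proj1 ml); move: (m 0 l - c) => z; clear; lia.
      have rm : rho m = m by apply: reflect_at_fix; apply/eqP; rewrite -subr_eq0 y0.
      move: vm t0; rewrite /v rm vmE /y y0; clear; lra.
    have [k1 mr] := reflect_at_near km (proj1 (andP kl)) ym1.
    have rm : rho m = k.
      rewrite mr; apply/rowP => i; rewrite !reflect_atE; case: eqVneq => // _; ring.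
    have tk := transversal_ge0 l k0 k.
    have vkE := @barrierE N l k0 k (k 0 l - c)%:~R erefl.
    move: vm vk t0 tk; rewrite /v rm (esym mr : rho k = m) vmE vkE /y k1 ym1; clear; lra.
  have y1 : 1 <= y by rewrite /y ler1z; move: ypos; move: (m 0 l - c) => z; clear; lia.
  have yN2 : y <= N%:R + 2 by rewrite /y -[2]/(2%:~R) pmulrn -intrD ler_int; exact: (proj2 ml).
  (* For offsets up to [N], a transversal coordinate beyond [N] would push the barrier to at least
     [256 * N ^ 2], which bounds the odd part of [w]. *)
  have [yN|/ltW yN] := lerP (m 0 l - c) N%:Z.
    have y_le : y <= N%:R by rewrite /y pmulrn ler_int.
    split; first by rewrite ypos.
    move=> i il; rewrite leNgt; apply/negP => bad.
    have tr := transversal_ge k0 m il.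
    have sq : N%:R ^+ 2 <= (m 0 i - k0 0 i)%:~R ^+ 2 :> R.
      rewrite -[leRHS]real_normK ?num_real // lerXn2r ?nnegrE //.
      by rewrite -intr_norm pmulrn ler_int ltW.
    have p : 0 <= y * (N%:R - y) by apply: mulr_ge0; move: y1 y_le; clear; lra.
    have p' : 0 <= y * N%:R by apply: mulr_ge0; move: y1 N1; clear; lra.
    move: vm phi_le tr sq p p'; rewrite /v vmE; clear; lra.
  (* Here [N <= y <= N + 2 <= 3 * N], and [5635 = 3 * 1793 + 256] gives [5635 * N * y - 1793 * y ^ 2
     >= 256 * N * y >= 256 * N ^ 2]. *)
  have y_ge : N%:R <= y by rewrite /y pmulrn ler_int.
  have p : 0 <= y * (3 * N%:R - y) by apply: mulr_ge0; move: y1 N1 yN2; clear; lra.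
  have p' : 0 <= N%:R * (y - N%:R) by apply: mulr_ge0; move: N1 y_ge; clear; lra.
  move: vm phi_le t0 p p'; rewrite /v vmE; clear; lra.
have Q1 : Q (k0 + ivec l).
  split; first by rewrite ivE eqxx /c; move: (k0 0 l) N0 => ?; clear; lia.
  by move=> i /negPf il; rewrite ivE il subrr normr0.
have := vQ _ Q1; rewrite /v /rho reflect_at_addiv eqxx.
have -> : reflect_at l c k0 = k0.
  by apply/rowP => i; rewrite reflect_atE; case: eqVneq => [->|//]; rewrite /c; ring.
(* At offset 1 the terms -1793 and 1793 cancel and the barrier equals [5635 * N]. *)
rewrite (@barrierE _ _ _ _ 1); last by rewrite ivE eqxx addrAC subrr add0r.
have -> : transversal l k0 (k0 + ivec l) = 0.
  by apply: big1 => i /negPf il; rewrite ivE il subrr expr0n mulr0.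
lra.
Qed.

(** The other sign comes from [256 * N ^ 2 - w], which obeys the same bounds and has right-hand side
    [- g]. *)
Lemma gradient_bound (N : nat) w g l k0 : (0 < N)%N ->
  (forall k, box (2 * N) k -> lap2 w k = g k) ->
  (forall k, box (2 * N) k -> `|g k| <= 1) ->
  (forall k, box (2 * N + 2) k -> 0 <= w k <= 256 * N%:R ^+ 2) ->
  box N k0 -> `|w (k0 + ivec l) - w (k0 - ivec l)| <= 5635 * N%:R.
Proof.
move=> N0 Lw g1 wb bk0; rewrite ler_norml (gradient_ub _ N0 Lw g1 wb bk0) andbT.
pose w' x := 256 * N%:R ^+ 2 + -1 * w x.
have : w' (k0 + ivec l) - w' (k0 - ivec l) <= 5635 * N%:R.
  apply: (@gradient_ub N w' (fun x => - g x) l k0) => // k bk.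
  - by rewrite /w' lap2D lap2_cst lap2Z Lw //; ring.
  - by rewrite normrN g1.
  - by rewrite /w'; have /andP[? ?] := wb _ bk; lra.
rewrite /w'; lra.
Qed.

Lemma poisson_gradient (N : nat) g : (0 < N)%N ->
  (forall k, box (2 * N) k -> `|g k| <= 1) ->
  exists w : lattice -> R,
    (forall k, box (2 * N) k -> lap2 w k = g k) /\
    (forall k l, box N k -> `|w (k + ivec l) - w (k - ivec l)| <= 5635 * N%:R).
Proof.
move=> N0 g1; have [|w [Lw wb]] := @poisson_box R (2 * N) g.
  by move=> k /g1; lra.
exists w; split=> // k l; apply: (gradient_bound l N0 Lw g1) => m /wb /andP[-> /le_trans -> //].
(* The bound of [poisson_box] for [M = 2 * N] is [16 * (2 * N + 2) ^ 2], at most [256 * N ^ 2] since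
   [N >= 1]. *)
have N1 : 1 <= N%:R :> R by rewrite ler1n.
have := mulr_ge0 (ler0n R N) (_ : 0 <= N%:R - 1); rewrite subr_ge0 natrD natrM => /(_ N1); nra.
Qed.

End InteriorGradientBound.

(** * A bounded right inverse of the discrete Dirac operator *)

Section OctonionDirac.
Variable R : realType.
Local Notation lattice := 'rV[int]_8.
Local Notation vec := 'rV[R]_8.

(** The library norm on matrices is the sup norm of the entries, unlike the Euclidean [enorm]. *)
Lemma mx_norm_le m n (x : 'M[R]_(m.+1, n.+1)) (c : R) : 0 <= c ->
  (forall i j, `|x i j| <= c) -> `|x| <= c.
Proof.
move=> c0 xc; rewrite /Num.norm /= mx_normrE.
by apply: bigmax_le => // -[i j] _ /=; exact: xc.
Qed.

Lemma mx_norm_coord m n (x : 'M[R]_(m.+1, n.+1)) i j : `|x i j| <= `|x|.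
Proof.
rewrite [leRHS]/Num.norm /= mx_normrE.
exact: (le_bigmax _ (fun ij => `|x ij.1 ij.2|) (i, j)).
Qed.

(* Integer copy of [oct_coef], so that the Clifford relations can be checked by
   computation. *)
Definition octz (i j k : nat) : int :=
  if i == 0%N then (j == k)%:R
  else if j == 0%N then (i == k)%:R
  else if i == j then - (k == 0%N)%:R
  else if oct_pos i j k then 1
  else if oct_pos j i k then -1
  else 0.

Lemma oct_coefE i j k : oct_coef R i j k = (octz i j k)%:~R.
Proof.
rewrite /oct_coef /octz; case: ifP => _; first by rewrite rmorph_nat.
case: ifP => _; first by rewrite rmorph_nat.
case: ifP => _; first by rewrite rmorphN /= rmorph_nat.
case: ifP => _; first by rewrite rmorph1.
by case: ifP => _; rewrite ?rmorph0 ?rmorphN1.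
Qed.

(** The sign by which octonion conjugation acts on the basis element [e_m]. *)
Definition conj_sgn (m : nat) : int := if m == 0%N then 1 else -1.

(** The Clifford relation in structure constants, with the sum in the shape produced by
    [big_ord_recl]; all 4096 index choices are then decided by computation. *)
Definition clifford_check (l m i k : nat) : bool :=
  let c j := conj_sgn m * octz m i j * octz l j k + conj_sgn l * octz l i j * octz m j k in
  c 0%N + (c 1%N + (c 2%N + (c 3%N + (c 4%N + (c 5%N + (c 6%N + (c 7%N + 0)))))))
  == ((l == m) && (i == k))%:R * 2.

Lemma clifford_checkT :
  all (fun l => all (fun m => all (fun i => all (clifford_check l m i) (iota 0 8))
    (iota 0 8)) (iota 0 8)) (iota 0 8).
Proof. by vm_compute. Qed.

Lemma octz_clifford (l m i k : 'I_8) :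
  \sum_(j < 8) (conj_sgn m * octz m i j * octz l j k
                + conj_sgn l * octz l i j * octz m j k) =
  ((l == m) && (i == k))%:R * 2.
Proof.
have mem (a : 'I_8) : (a : nat) \in iota 0 8 by rewrite mem_iota /= ltn_ord.
have /allP/(_ _ (mem l))/allP/(_ _ (mem m))/allP/(_ _ (mem i))/allP/(_ _ (mem k)) :=
  clifford_checkT.
by move=> /eqP <-; rewrite !big_ord_recl big_ord0.
Qed.

Definition ebar (m : 'I_8) : vec := (conj_sgn m)%:~R *: evec R m.

Lemma omul_sumr (x : vec) I (r : seq I) (P : pred I) (F : I -> vec) :
  omul x (\sum_(i <- r | P i) F i) = \sum_(i <- r | P i) omul x (F i).
Proof.
elim/big_rec2: _ => [|i y z _ <-]; apply/rowP => k; rewrite !mxE.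
  by rewrite big1 // => a _; rewrite big1 // => b _; rewrite mxE mulr0 mul0r.
rewrite -big_split /=; apply: eq_bigr => a _; rewrite -big_split /=.
by apply: eq_bigr => b _; rewrite mxE; ring.
Qed.

Lemma omulZr (x : vec) c (y : vec) : omul x (c *: y) = c *: omul x y.
Proof.
apply/rowP => k; rewrite !mxE mulr_sumr; apply: eq_bigr => a _.
by rewrite mulr_sumr; apply: eq_bigr => b _; rewrite mxE; ring.
Qed.

Lemma omulDr (x y z : vec) : omul x (y + z) = omul x y + omul x z.
Proof.
apply/rowP => k; rewrite !mxE -big_split /=; apply: eq_bigr => a _.
by rewrite -big_split /=; apply: eq_bigr => b _; rewrite mxE; ring.
Qed.

Lemma omulBr (x y z : vec) : omul x (y - z) = omul x y - omul x z.
Proof. by rewrite -[- z]scaleN1r omulDr omulZr scaleN1r. Qed.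

Lemma omul0r (x : vec) : omul x 0 = 0.
Proof. by rewrite -(scale0r (0 : vec)) omulZr !scale0r. Qed.

Lemma omul_norm (x y : vec) : `|omul x y| <= 64 * `|x| * `|y|.
Proof.
have xy0 : 0 <= `|x| * `|y| by rewrite mulr_ge0.
apply: mx_norm_le; first by rewrite -mulrA mulr_ge0.
move=> i0 k; rewrite mxE; apply: le_trans (ler_norm_sum _ _ _) _.
have -> : 64 * `|x| * `|y| = \sum_(i < 8) \sum_(j < 8) `|x| * `|y|.
  by rewrite !sumr_const card_ord; ring.
apply: ler_sum => i _; apply: le_trans (ler_norm_sum _ _ _) _.
apply: ler_sum => j _; rewrite !normrM -[leRHS]mulr1.
apply: ler_pM; rewrite ?mulr_ge0 //; first by apply: ler_pM => //; exact: mx_norm_coord.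
have octb a b c : `|oct_coef R a b c| <= 1.
  rewrite /oct_coef; do 5?[case: ifP => _]; rewrite ?normrN ?normr1 ?normr0 //;
  by case: (_ == _); rewrite ?normr1 ?normr0.
exact: octb.
Qed.

Lemma omul_evecE l (x : vec) k : omul (evec R l) x 0 k = \sum_(j < 8) x 0 j * oct_coef R l j k.
Proof.
rewrite mxE (bigD1 l) //= [X in _ + X]big1 => [|i /negPf il].
  by rewrite addr0; apply: eq_bigr => j _; rewrite mxE !eqxx mul1r.
by rewrite big1 // => j _; rewrite mxE il andbF !mul0r.
Qed.

Lemma omul_ebarE m (x : vec) k :
  omul (ebar m) x 0 k = \sum_(j < 8) (conj_sgn m)%:~R * (x 0 j * oct_coef R m j k).
Proof.
rewrite -mulr_sumr -omul_evecE !mxE mulr_sumr; apply: eq_bigr => i _.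
by rewrite mulr_sumr; apply: eq_bigr => j _; rewrite !mxE; ring.
Qed.

(** Polarised form of [e (conj e x) = |e|^2 x], an instance of alternativity that survives the
    failure of associativity; it is read off from the structure constants. *)
Lemma clifford l m (x : vec) :
  omul (evec R l) (omul (ebar m) x) + omul (evec R m) (omul (ebar l) x) =
  (l == m)%:R *: (x *+ 2).
Proof.
apply/rowP => k; rewrite mxE !omul_evecE -big_split /=.
under eq_bigr => j _.
  rewrite !omul_ebarE !mulr_suml -big_split /=.
  under eq_bigr => i _.
    have -> : (conj_sgn m)%:~R * (x 0 i * oct_coef R m i j) * oct_coef R l j k +
       (conj_sgn l)%:~R * (x 0 i * oct_coef R l i j) * oct_coef R m j k =
       x 0 i * (conj_sgn m * octz m i j * octz l j k
                + conj_sgn l * octz l i j * octz m j k)%:~R.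
      by rewrite !oct_coefE rmorphD !rmorphM /=; ring.
    over.
  over.
rewrite exchange_big /=.
under eq_bigr => i _ do rewrite -mulr_sumr -rmorph_sum /= octz_clifford.
rewrite (bigD1 k) //= eqxx andbT big1 => [|i /negPf ik].
  by rewrite addr0 !mxE rmorphM /= rmorph_nat; ring.
by rewrite ik andbF mul0r mulr0.
Qed.

Lemma norm_evec (l : 'I_8) : `|evec R l| <= 1.
Proof.
apply: mx_norm_le => // i j; rewrite mxE.
by case: (_ && _); rewrite ?normr1 ?normr0.
Qed.

Lemma norm_ebar m : `|ebar m| <= 1.
Proof.
rewrite /ebar normrZ /conj_sgn; case: (_ == _); rewrite ?rmorphN ?normrN /= normr1 mul1r;
exact: norm_evec.
Qed.

Lemma DhB (h : R) (F G : lattice -> vec) k :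
  Dh h (fun x => F x - G x) k = Dh h F k - Dh h G k.
Proof.
rewrite /Dh -sumrB; apply: eq_bigr => l _; rewrite -omulBr -scalerBr.
by congr (omul _ (_ *: _)); rewrite !opprD addrACA.
Qed.

(** The second differences [d l m] are symmetric, so adding the double sum to its transpose cancels
    the off-diagonal terms by [clifford]. The factor [2 * h] undoes the normalisation of [Dh]. *)
Lemma Dh_dirac_conj (h : R) (W : lattice -> vec) k : h != 0 ->
  Dh h (fun x => (2 * h) *: \sum_m omul (ebar m) (W (x + ivec m) - W (x - ivec m))) k =
  \sum_l (W (k + ivec l + ivec l) + W (k - ivec l - ivec l) - W k *+ 2).
Proof.
move=> h0; pose d l m := (W (k + ivec l + ivec m) - W (k + ivec l - ivec m))
  - (W (k - ivec l + ivec m) - W (k - ivec l - ivec m)).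
have dC l m : d l m = d m l.
  rewrite /d (addrAC k (ivec m) (ivec l)) (addrAC k (ivec m) (- ivec l)).
  by rewrite (addrAC k (- ivec m) (ivec l)) (addrAC k (- ivec m) (- ivec l)) !opprD addrACA.
pose T l m := omul (evec R l) (omul (ebar m) (d l m)).
transitivity (\sum_l \sum_m T l m).
  rewrite /Dh; apply: eq_bigr => l _.
  rewrite -scalerBr scalerA mulVf ?mulf_neq0 ?pnatr_eq0 // scale1r -sumrB.
  by rewrite omul_sumr; apply: eq_bigr => m _; rewrite -omulBr.
have two : (\sum_l \sum_m T l m) *+ 2 = (\sum_l d l l) *+ 2.
  rewrite mulr2n {2}exchange_big -big_split -sumrMnl /=; apply: eq_bigr => l _.
  rewrite -big_split /= (bigD1 l) //= big1 => [|m /negPf ml].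
    by rewrite addr0 /T clifford eqxx scale1r.
  by rewrite /T (dC m l) clifford eq_sym ml scale0r.
have two0 : (2 : R) != 0 by rewrite pnatr_eq0.
have -> : \sum_l \sum_m T l m = \sum_l d l l.
  by apply: (scalerI two0); rewrite !scaler_nat.
by apply: eq_bigr => l _; rewrite /d !addrK subrK mulr2n opprB [in RHS]opprD addrACA.
Qed.

(** Each component solves a Poisson problem with data [g / eta]; the gradient bound, of order [N],
    times the factor [2 * h] yields the physical size [h * N]. *)
Lemma Dh_solve : exists2 C : R, 0 < C &
  forall (h eta : R) (N : nat) (g : lattice -> vec), 0 < h -> 0 < eta -> (0 < N)%N ->
  (forall k, box (2 * N) k -> `|g k| <= eta) ->
  exists u : lattice -> vec, (forall k, box (2 * N) k -> Dh h u k = g k) /\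
    (forall k, box N k -> `|u k| <= C * (h * N%:R) * eta).
Proof.
(* 2 from [2 * h], 8 summands, 64 from [omul_norm], 5635 from the gradient bound. *)
exists (2 * (8 * (64 * 5635))) => [|h eta N g h0 eta0 N0 gb]; first by lra.
have /choice[w wP] : forall c : 'I_8, exists w : lattice -> R,
    (forall k, box (2 * N) k -> lap2 w k = eta^-1 * g k 0 c) /\
    (forall k l, box N k -> `|w (k + ivec l) - w (k - ivec l)| <= 5635 * N%:R).
  move=> c; apply: poisson_gradient => // k /gb gk.
  rewrite normrM gtr0_norm ?invr_gt0 // ler_pdivrMl // mulr1.
  exact: le_trans (mx_norm_coord _ _ _) gk.
pose W k : vec := eta *: \row_c w c k.
have Wd k l : box N k -> `|W (k + ivec l) - W (k - ivec l)| <= eta * (5635 * N%:R).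
  move=> bk; rewrite -scalerBr normrZ gtr0_norm // ler_pM2l //.
  apply: mx_norm_le; first by rewrite mulr_ge0 ?ler0n.
  by move=> i c; rewrite !mxE; apply: (wP c).2.
exists (fun x => (2 * h) *: \sum_m omul (ebar m) (W (x + ivec m) - W (x - ivec m))).
split=> k bk.
  rewrite Dh_dirac_conj ?gt_eqF //; apply/rowP => c; rewrite summxE.
  rewrite -[RHS](mulVKf (lt0r_neq0 eta0)) -(wP c).1 // /lap2.
  rewrite mulr_sumr; apply: eq_bigr => l _; rewrite !mxE; ring.
rewrite normrZ gtr0_norm ?mulr_gt0 //.
have -> : 2 * (8 * (64 * 5635)) * (h * N%:R) * eta =
  2 * h * (\sum_(m < 8) 64 * 1 * (eta * (5635 * N%:R))).
  by rewrite sumr_const card_ord; ring.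
rewrite ler_pM2l ?mulr_gt0 //; apply: le_trans (ler_norm_sum _ _ _) _.
apply: ler_sum => m _; apply: le_trans (omul_norm _ _) _.
apply: ler_pM; rewrite ?mulr_ge0 ?ler0n ?normr_ge0 //; last exact: Wd.
by rewrite ler_pM2l // norm_ebar.
Qed.

End OctonionDirac.

(** * Local analysis near the closure of the domain *)

Section LocalAnalysis.
Variable R : realType.
Local Notation vec := 'rV[R]_8.
Implicit Types (B K : set vec) (x y z p v : vec) (f : vec -> vec).

Lemma vecBE x y i : (x - y) 0 i = x 0 i - y 0 i.
Proof. by rewrite !mxE. Qed.

Lemma nbhs_vecP n (p : 'rV[R]_n.+1) (A : set 'rV[R]_n.+1) :
  nbhs p A <-> exists2 e : R, 0 < e & forall q, `|q - p| < e -> A q.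
Proof.
split=> [/nbhs_ballP[e /= e0 eA]|[e e0 eA]].
  by exists e => // q qp; apply: eA; rewrite mx_norm_ball /ball_ /= distrC.
by apply/nbhs_ballP; exists e => //= q; rewrite mx_norm_ball /ball_ /= distrC => /eA.
Qed.

Lemma closure_vecP B p :
  closure B p <-> forall e : R, 0 < e -> exists2 y, B y & `|y - p| < e.
Proof.
split=> [cB e e0|cB A /nbhs_vecP[e e0 eA]].
  have [|y [By ye]] := cB [set y | `|y - p| < e]; last by exists y.
  by apply/nbhs_vecP; exists e.
by have [y By yp] := cB _ e0; exists y; split=> //; exact: eA.
Qed.

Lemma open_vecP B p : open B -> B p -> exists2 e : R, 0 < e & forall y, `|y - p| < e -> B y.
Proof. by rewrite openE => oB Bp; apply/nbhs_vecP/oB. Qed.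

Lemma seq_uniform (T : eqType) (s : seq T) (P : T -> R -> Prop) :
  (forall q (a b : R), a <= b -> P q b -> P q a) ->
  (forall q, q \in s -> exists2 e, 0 < e & P q e) ->
  exists2 e, 0 < e & forall q, q \in s -> P q e.
Proof.
move=> Pm; elim: s => [|a s IH] Ps; first by exists 1.
have [e1 e10 Pe1] := Ps a (mem_head _ _).
have [|e2 e20 Pe2] := IH; first by move=> q qs; apply: Ps; rewrite inE qs orbT.
exists (Num.min e1 e2); first by rewrite lt_min e10.
move=> q; rewrite inE => /orP[/eqP ->|/Pe2].
  by apply: Pm Pe1; rewrite ge_min lexx.
by apply: Pm; rewrite ge_min lexx orbT.
Qed.

Lemma compact_finite_balls K (r : vec -> R) : compact K -> (forall p, K p -> 0 < r p) ->
  exists2 s : seq vec, (forall p, p \in s -> K p) &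
    forall x, K x -> exists2 p, p \in s & `|x - p| < r p.
Proof.
rewrite compact_cover => cK r0.
have [|x Kx|D DK cov] := cK vec K (fun p => [set x | `|x - p| < r p]).
- move=> p Kp; rewrite openE => x /= xp; apply/nbhs_vecP; exists (r p - `|x - p|).
    by rewrite subr_gt0.
  move=> y yx /=; rewrite -(subrKA x).
  by apply: le_lt_trans (ler_normD _ _) _; rewrite -ltrBrDr.
- by exists x => //=; rewrite subrr normr0 r0.
exists (finmap.enum_fset D) => [p pD|x Kx]; first by have := DK _ pD; rewrite inE.
by have [p pD xp] := cov _ Kx; exists p.
Qed.

(** Lebesgue number argument: finitely many balls of half the admissible radius cover [K], and a
    point [x] close to [K], possibly outside it, remains in a full ball. *)
Lemma compact_uniform K (Q : R -> vec -> Prop) : compact K ->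
  (forall a b x, a <= b -> Q b x -> Q a x) ->
  (forall p, K p -> exists2 e, 0 < e & forall x, `|x - p| < e -> Q e x) ->
  exists2 e, 0 < e & forall p x, K p -> `|x - p| < e -> Q e x.
Proof.
move=> cK Qm Qloc.
have /choice[r rP] : forall p, exists r : R,
    K p -> 0 < r /\ forall x, `|x - p| < r -> Q r x.
  move=> p; have [/Qloc[e e0 eQ]|nK] := pselect (K p); first by exists e.
  by exists 0 => /nK.
have [|s sK scov] := compact_finite_balls (r := fun p => r p / 2) cK.
  by move=> p /rP[? _]; rewrite divr_gt0.
have [|p /sK/rP[r0 _]|e e0 es] := @seq_uniform _ s (fun p e => e <= r p / 2).
- by move=> p a b ab /(le_trans ab).
- by exists (r p / 2); rewrite ?divr_gt0.
exists e => // p x Kp xp; have [q qs pq] := scov _ Kp.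
have [r0 rQ] := rP _ (sK _ qs); have eq2 := es _ qs.
apply: Qm (rQ x _); first lra.
rewrite -(subrKA p); apply: le_lt_trans (ler_normD _ _) _; lra.
Qed.

Lemma enorm_le x : enorm x <= 8 * `|x|.
Proof.
have x0 : 0 <= 8 * `|x| by rewrite mulr_ge0.
rewrite /enorm -(ger0_norm x0) -sqrtr_sqr ler_wsqrtr //.
have -> : (8 * `|x|) ^+ 2 = \sum_(i < 8) 8 * `|x| ^+ 2.
  by rewrite sumr_const card_ord; ring.
apply: ler_sum => i _; have := mx_norm_coord x 0 i; rewrite -[x 0 i ^+ 2]real_normK ?num_real //.
have := normr_ge0 (x 0 i); nra.
Qed.

Lemma mulmx_norm x (A : 'M[R]_8) : `|x *m A| <= 8 * (`|x| * `|A|).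
Proof.
have xA : 0 <= `|x| * `|A| by rewrite mulr_ge0.
apply: mx_norm_le => [|i j]; first by rewrite mulr_ge0.
rewrite mxE; apply: le_trans (ler_norm_sum _ _ _) _.
have -> : 8 * (`|x| * `|A|) = \sum_(k < 8) `|x| * `|A|.
  by rewrite sumr_const card_ord; ring.
by apply: ler_sum => k _; rewrite normrM; apply: ler_pM => //; exact: mx_norm_coord.
Qed.

(** Moving against the last axis, rotated back by [Q^T], lowers the graph coordinate and fixes the
    others. Points of the closure satisfy the weak graph inequality, and the shift makes it
    strict. *)
Lemma graph_inward (Q : 'M[R]_8) (phi : 'rV[R]_7 -> R) B p (r : R) : 0 < r ->
  Q *m Q^T = 1%:M -> (forall q : 'rV[R]_7, {for q, continuous phi}) ->
  (forall x, enorm (x - p) < r ->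
    (B x <-> let y := (x - p) *m Q in
       y 0 ord_max < phi (\row_(i < 7) y 0 (widen_ord (leqnSn 7) i)))) ->
  exists2 e : R, 0 < e & exists v, forall x t, 0 < t < e -> closure B x ->
    `|x - p| < e -> B (x - t *: v).
Proof.
move=> r0 QQ phic graph; pose c := 8 * `|Q|.
have c0 : 0 <= c by rewrite mulr_ge0.
pose Y x := (x - p) *m Q; pose low (y : vec) : 'rV[R]_7 := \row_i y 0 (widen_ord (leqnSn 7) i).
have low_norm y : `|low y| <= `|y|.
  by apply: mx_norm_le => // i j; rewrite mxE; exact: mx_norm_coord.
have lowB y z : low y - low z = low (y - z) by apply/rowP => i; rewrite !mxE.
have YB x z : `|Y x - Y z| <= c * `|x - z|.
  rewrite /Y -mulmxBl opprB addrA subrK /c.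
  by have := mulmx_norm (x - z) Q; rewrite -mulrA mulrCA (mulrC `|Q|) mulrCA.
(* The factor 8 compares [enorm] with the sup norm; [2 + c] leaves room for a shift by [t *: v] with
   [t < e] and [|v| <= 1 + c]. *)
pose e := r / (8 * (2 + c)).
have e0 : 0 < e by rewrite divr_gt0 // mulr_gt0 //; lra.
have er : 8 * (2 + c) * e = r by rewrite /e mulrC divfK // gt_eqF // mulr_gt0 //; lra.
have near x : `|x - p| < e + e * (1 + c) -> enorm (x - p) < r.
  move=> xp; apply: le_lt_trans (enorm_le _) _; lra.
(* If [x] were above the graph by [d], at a nearby point of [B] each side would change by at most
   [d / 2], violating the strict inequality. *)
have cls x : closure B x -> `|x - p| < e -> Y x 0 ord_max <= phi (low (Y x)).
  move=> cx xp; rewrite leNgt; apply/negP => bad.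
  pose d := Y x 0 ord_max - phi (low (Y x)).
  have d2 : 0 < d / 2 by rewrite divr_gt0 // subr_gt0.
  have /nbhs_vecP[d1 d10 d1P] : nbhs (low (Y x)) [set q | `|phi q - phi (low (Y x))| <= d / 2].
    by move/cvgrPdistC_le : (phic (low (Y x))) => /(_ _ d2).
  pose a := Num.min e (Num.min d1 (d / 2) / (1 + c)).
  have c1 : 0 < 1 + c by lra.
  have a0 : 0 < a by rewrite lt_min e0 /= divr_gt0 // lt_min d10.
  have ae : a <= e by rewrite ge_min lexx.
  have ac : a * (1 + c) <= Num.min d1 (d / 2) by rewrite -ler_pdivlMr // ge_min lexx orbT.
  have [x1 Bx1 x1x] := (closure_vecP _ _).1 cx _ a0.
  have /graph[/(_ Bx1) /= + _] : enorm (x1 - p) < r.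
    apply: near; rewrite -(subrKA x); apply: le_lt_trans (ler_normD _ _) _; nra.
  rewrite -/(Y x1) -/(low (Y x1)).
  have x1x0 := normr_ge0 (x1 - x).
  have Yd : `|Y x1 - Y x| < Num.min d1 (d / 2).
    apply: le_lt_trans (YB _ _) _; apply: lt_le_trans ac; nra.
  have /d1P /= : `|low (Y x1) - low (Y x)| < d1.
    by rewrite lowB; apply: le_lt_trans (low_norm _) _; move: Yd; rewrite lt_min => /andP[].
  have : `|Y x1 0 ord_max - Y x 0 ord_max| < d / 2.
    have := mx_norm_coord (Y x1 - Y x) 0 ord_max; rewrite !mxE => /le_lt_trans; apply.
    by move: Yd; rewrite lt_min => /andP[].
  rewrite ltr_norml ler_norml /d; lra.
pose v := evec R ord_max *m Q^T : vec.
exists e => //; exists v => x t /andP[t0 te] cx xp.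
have Yv : Y (x - t *: v) = Y x - t *: evec R ord_max.
  rewrite /Y addrAC mulmxBl -scalemxAl /v -mulmxA.
  by rewrite (mulmx1C QQ) mulmx1.
have vn : `|v| <= 1 + c.
  apply: (@le_trans _ _ c); last by lra.
  apply: le_trans (mulmx_norm _ _) _; rewrite /c ler_pM2l //.
  rewrite -[leRHS]mul1r; apply: ler_pM => //; first exact: norm_evec.
  by apply: mx_norm_le => // i j; rewrite mxE; exact: mx_norm_coord.
have /graph[_] : enorm (x - t *: v - p) < r.
  apply: near; rewrite addrAC; apply: le_lt_trans (ler_normB _ _) _.
  rewrite normrZ gtr0_norm //; have := normr_ge0 v; nra.
apply; rewrite /= -/(Y _) -/(low _) Yv.
have -> : low (Y x - t *: evec R ord_max) = low (Y x).
  apply/rowP => i; rewrite !mxE /= [_ == ord_max]negbTE ?mulr0 ?subr0 //.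
  by apply/eqP => /(congr1 val) /= i7; have := ltn_ord i; rewrite i7 ltnn.
have := cls _ cx xp; rewrite !mxE !eqxx /=; lra.
Qed.

Lemma C3_boundary_inward B p : open B -> C3_boundary B -> closure B p ->
  exists2 e : R, 0 < e & exists2 v, `|v| <= 1 & forall x t, 0 < t < e -> closure B x ->
    `|x - p| < e -> B (x - t *: v).
Proof.
move=> oB bB cBp; have [Bp|nBp] := pselect (B p).
  have [e e0 eB] := open_vecP oB Bp.
  exists e => //; exists 0; first by rewrite normr0.
  by move=> x t _ _ xp; rewrite scaler0 subr0; exact: eB.
have [|r [Q [phi [r0 [QQ [phiC graph]]]]]] := bB p.
  by split=> // /interior_subset.
have phic (q : 'rV[R]_7) : {for q, continuous phi} by apply: (phiC [::] _).1.
have [e e0 [v vB]] := graph_inward r0 QQ phic graph.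
have v0 : 0 < 1 + `|v| by rewrite ltr_wpDr.
exists e => //; exists ((1 + `|v|)^-1 *: v).
  rewrite normrZ gtr0_norm ?invr_gt0 // ler_pdivrMl // mulr1; lra.
move=> x t /andP[t0 te] cx xp; rewrite scalerA; apply: vB => //.
rewrite divr_gt0 //= ltr_pdivrMr //; have := normr_ge0 v; nra.
Qed.

(** [Dh] at arbitrary points, since the translates of [f] are evaluated off the lattice. *)
Definition central_dirac (h : R) f x : vec :=
  \sum_(l < 8) omul (evec R l)
    ((2 * h)^-1 *: (f (x + h *: evec R l) - f (x - h *: evec R l))).

(** By the mean value theorem, each coordinate of the central difference is that of the partial
    derivative at some point near [z]. Uniformity in [x] serves the later compactness argument. *)
Lemma central_diff_pd B f z (l : 'I_8) (eta : R) : open B -> Ck_open 1 B f -> B z ->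
  0 < eta -> exists2 e : R, 0 < e & forall x (h : R), `|x - z| < e -> 0 < h < e ->
    `|(2 * h)^-1 *: (f (x + h *: evec R l) - f (x - h *: evec R l)) - pd l f z| <= eta.
Proof.
move=> oB fC Bz eta0; have [e1 e10 e1B] := open_vecP oB Bz.
have cpd : {for z, continuous (pd l f)} by apply: (fC [:: l] _).1.
have /nbhs_vecP[e2 e20 e2P] : nbhs z [set y | `|pd l f y - pd l f z| <= eta].
  by move/cvgrPdistC_le : cpd => /(_ _ eta0).
exists (Num.min e1 e2 / 2); first by rewrite divr_gt0 // lt_min e10.
move=> x h xz /andP[h0 he]; apply: mx_norm_le; first exact: ltW.
move=> i c; rewrite ord1 {i}; pose phi (s : R) : R := f (x + s *: evec R l) 0 c.
have near (s : R) : `|s| <= h -> `|x + s *: evec R l - z| < Num.min e1 e2.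
  move=> sh; rewrite addrAC; apply: le_lt_trans (ler_normD _ _) _.
  rewrite normrZ; have := norm_evec R l; have := normr_ge0 s; nra.
have near1 (s : R) : `|s| <= h -> B (x + s *: evec R l).
  by move=> /near; rewrite lt_min => /andP[/e1B].
have dphi (s : R) : `|s| <= h -> is_derive s 1 phi (pd l f (x + s *: evec R l) 0 c).
  move=> /near1 Bs; have df : derivable f (x + s *: evec R l) (evec R l).
    by apply: (fC [::] _).2.
  have quotE (a : R) : a^-1 *: (phi (a *: (1 : R) + s) - phi s) =
      (a^-1 *: (f (a *: evec R l + (x + s *: evec R l)) - f (x + s *: evec R l))) 0 c.
    rewrite !mxE /phi; congr (_ * (f _ 0 c - _)).
    by rewrite scalerDl /= scaler1 addrCA.
  have cq : (fun a : R => a^-1 *: (phi (a *: (1 : R) + s) - phi s)) @ 0^' -->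
      pd l f (x + s *: evec R l) 0 c.
    have cv : (fun a : R => a^-1 *: (f (a *: evec R l + (x + s *: evec R l))
        - f (x + s *: evec R l))) @ 0^' --> pd l f (x + s *: evec R l) by exact: df.
    apply/cvgrPdist_le => d d0; move/cvgrPdist_le : cv => /(_ _ d0).
    apply: filterS => a; apply: le_trans; rewrite quotE.
    have := mx_norm_coord (pd l f (x + s *: evec R l) - a^-1 *: (f (a *: evec R l
        + (x + s *: evec R l)) - f (x + s *: evec R l))) 0 c.
    by rewrite vecBE.
  by apply: DeriveDef; [apply/cvg_ex; exists (pd l f (x + s *: evec R l) 0 c)|exact: cvg_lim cq].
have [|||s sh] := @MVT R phi (fun s => pd l f (x + s *: evec R l) 0 c) (- h) h.
- lra.
- by move=> s; rewrite in_itv /= => sh; apply: dphi; rewrite ler_norml; lra.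
- apply: derivable_within_continuous => s; rewrite in_itv /= => sh.
  by have [] : is_derive s 1 phi (pd l f (x + s *: evec R l) 0 c)
    by apply: dphi; rewrite ler_norml; lra.
rewrite /phi scaleNr => eq1; rewrite !mxE eq1.
have -> : h - - h = 2 * h by lra.
rewrite mulrC mulfK ?mulf_neq0 ?pnatr_eq0 ?gt_eqF //.
have /near : `|s| <= h by move: sh; rewrite in_itv /= ler_norml; lra.
rewrite lt_min => /andP[_ /e2P /=]; apply: le_trans.
by have := mx_norm_coord (pd l f (x + s *: evec R l) - pd l f z) 0 c; rewrite !mxE.
Qed.

Lemma central_dirac_small B f z (eta : R) : open B -> Ck_open 1 B f -> B z ->
  Dirac f z = 0 -> 0 < eta -> exists2 e : R, 0 < e & forall x (h : R),
    `|x - z| < e -> 0 < h < e -> `|central_dirac h f x| <= eta.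
Proof.
move=> oB fC Bz Df eta0.
(* 512 is 8 directions times the constant 64 of [omul_norm]. *)
have eta1 : 0 < eta / 512 by rewrite divr_gt0 ?ltr0n.
have [|l _|e e0 eP] := @seq_uniform _ (enum 'I_8) (fun l e => forall x (h : R),
   `|x - z| < e -> 0 < h < e -> `|(2 * h)^-1 *: (f (x + h *: evec R l)
      - f (x - h *: evec R l)) - pd l f z| <= eta / 512).
- move=> l a b ab Pb x h xa /andP[h0 ha]; apply: Pb; first exact: lt_le_trans ab.
  by rewrite h0 (lt_le_trans ha).
- exact: (central_diff_pd l oB fC Bz eta1).
exists e => // x h xz he; rewrite -[X in `|X|]subr0 -Df /central_dirac /Dirac -sumrB.
apply: le_trans (ler_norm_sum _ _ _) _.
have -> : eta = \sum_(l < 8) 64 * 1 * (eta / 512).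
  by rewrite sumr_const card_ord; field.
apply: ler_sum => l _; rewrite -omulBr; apply: le_trans (omul_norm _ _) _.
apply: ler_pM; rewrite ?mulr_ge0 //.
  by rewrite ler_pM2l // norm_evec.
by apply: eP => //; rewrite mem_enum.
Qed.

End LocalAnalysis.

(** * Gluing by a partition of unity *)

Section PartitionOfUnity.
Variable R : realType.
Local Notation vec := 'rV[R]_8.
Implicit Types (B K : set vec) (x y z p v : vec) (f : vec -> vec).

Lemma within_uniform K f (eta : R) : compact K -> {within K, continuous f} -> 0 < eta ->
  exists2 e : R, 0 < e & forall x y, K x -> K y -> `|x - y| < e -> `|f x - f y| <= eta.
Proof.
move=> cK /subspace_continuousP fc eta0.
have [|p Kp|e e0 eP] := @compact_uniform R K (fun e x => K x -> forall y, K y ->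
  `|x - y| < e -> `|f x - f y| <= eta) cK.
- by move=> a b x ab Qb Kx y Ky xy; apply: Qb => //; exact: lt_le_trans ab.
- have eta2 : 0 < eta / 2 by rewrite divr_gt0.
  have /nbhs_vecP[d d0 dP] : nbhs p [set x | K x -> `|f x - f p| <= eta / 2].
    by move/cvgrPdistC_le : (fc _ Kp) => /(_ _ eta2).
  exists (d / 2); first by rewrite divr_gt0.
  move=> x xp Kx y Ky xy; rewrite -(subrKA (f p)).
  have /dP/(_ Kx) /= h1 : `|x - p| < d by lra.
  have /dP/(_ Ky) /= : `|y - p| < d.
    rewrite -(subrKA x); apply: le_lt_trans (ler_normD _ _) _.
    by rewrite (distrC y x); lra.
  by rewrite distrC => h2; apply: le_trans (ler_normD _ _) _; lra.
by exists e => // x y Kx Ky xy; apply: (eP x x) => //; rewrite subrr normr0.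
Qed.

(* Because the weights sum to 1 at every point, a constant [f0] may be
   subtracted from all pieces, so that only the oscillation of the pieces is
   multiplied by the difference quotients of the weights. *)
Lemma central_dirac_glue (s : seq vec) (chi : vec -> vec -> R) (g : vec -> vec -> vec)
    x (f0 : vec) (h eta kappa : R) : 0 < h -> 0 <= eta -> 0 <= kappa ->
  \sum_(p <- s) chi p x = 1 ->
  (forall l, \sum_(p <- s) chi p (x + h *: evec R l) = 1 /\
             \sum_(p <- s) chi p (x - h *: evec R l) = 1) ->
  (forall p, p \in s -> 0 <= chi p x) ->
  (forall p, p \in s -> chi p x != 0 -> `|central_dirac h (g p) x| <= eta) ->
  (forall p l, p \in s ->
    `|(chi p (x + h *: evec R l) - chi p x) *: (g p (x + h *: evec R l) - f0)|
      <= h * kappa /\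
    `|(chi p (x - h *: evec R l) - chi p x) *: (g p (x - h *: evec R l) - f0)|
      <= h * kappa) ->
  `|central_dirac h (fun y => \sum_(p <- s) chi p y *: g p y) x|
    <= eta + 512 * (size s)%:R * kappa.
Proof.
move=> h0 eta0 kappa0 sum1 sum1l chi0 small osc.
pose xp l := x + h *: evec R l; pose xm l := x - h *: evec R l.
pose E p l := (chi p (xp l) - chi p x) *: (g p (xp l) - f0)
            - (chi p (xm l) - chi p x) *: (g p (xm l) - f0).
(* Discrete product rule with the weights frozen at [x]; the [f0] terms cancel because the weights
   sum to 1 at both stencil points. *)
have GE l : \sum_(p <- s) chi p (xp l) *: g p (xp l) - \sum_(p <- s) chi p (xm l) *: g p (xm l)
    = \sum_(p <- s) chi p x *: (g p (xp l) - g p (xm l)) + \sum_(p <- s) E p l.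
  have Z : \sum_(p <- s) (chi p (xp l) - chi p (xm l)) *: f0 = 0.
    rewrite -scaler_suml sumrB; have [-> ->] := sum1l l; by rewrite subrr scale0r.
  rewrite -[LHS]subr0 -[X in _ - X = _]Z -!sumrB -big_split /=; apply: eq_bigr => p _.
  by apply/rowP => c; rewrite /E !mxE; ring.
have -> : central_dirac h (fun y => \sum_(p <- s) chi p y *: g p y) x =
    \sum_(p <- s) chi p x *: central_dirac h (g p) x +
    \sum_(l < 8) omul (evec R l) ((2 * h)^-1 *: \sum_(p <- s) E p l).
  rewrite /central_dirac.
  under eq_bigr => l _ do rewrite -/(xp l) -/(xm l) GE scalerDr omulDr.
  rewrite big_split /=; congr (_ + _).
  under eq_bigr => l _ do rewrite scaler_sumr omul_sumr.
  rewrite exchange_big /=; apply: eq_bigr => p _; rewrite scaler_sumr.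
  by apply: eq_bigr => l _; rewrite scalerA mulrC -scalerA omulZr.
apply: le_trans (ler_normD _ _) _; apply: lerD.
  apply: le_trans (ler_norm_sum _ _ _) _.
  rewrite -[leRHS]mul1r -sum1 mulr_suml big_seq [leRHS]big_seq.
  apply: ler_sum => p ps; rewrite normrZ ger0_norm ?chi0 //.
  have [->|c0] := eqVneq (chi p x) 0; first by rewrite !mul0r.
  by rewrite ler_wpM2l ?chi0 // small.
(* 8 directions times 64; per piece, the two errors [h * kappa] absorb [(2 * h)^-1]. *)
have -> : 512 * (size s)%:R * kappa =
    \sum_(l < 8) 64 * 1 * ((2 * h)^-1 * (\sum_(p <- s) (h * kappa + h * kappa))).
  rewrite !sumr_const big_const_seq count_predT iter_addr addr0 card_ord.
  by field; rewrite gt_eqF.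
apply: le_trans (ler_norm_sum _ _ _) _; apply: ler_sum => l _.
apply: le_trans (omul_norm _ _) _; apply: ler_pM; rewrite ?mulr_ge0 //.
  by rewrite ler_pM2l // norm_evec.
have h20 : 0 < (2 * h)^-1 by rewrite invr_gt0 mulr_gt0.
rewrite normrZ gtr0_norm // ler_pM2l //.
apply: le_trans (ler_norm_sum _ _ _) _; rewrite big_seq [leRHS]big_seq.
apply: ler_sum => p ps; apply: le_trans (ler_normB _ _) _.
by have [e1 e2] := osc _ l ps; exact: lerD.
Qed.

(** The difference is [((a' - a) + (a / S) * (S - S')) / S'] with [a / S <= 1]. It is used with [a]
    a bump and [S] the sum of [n] bumps. *)
Lemma normalized_lipschitz (a a' S S' d n h : R) : 0 < d -> d <= S -> d <= S' ->
  0 <= a <= S -> 0 <= h -> 0 <= n -> `|a' - a| <= h -> `|S' - S| <= n * h ->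
  `|a' / S' - a / S| <= h * ((n + 1) / d).
Proof.
move=> d0 dS dS' /andP[a0 aS] h0 n0 ah Sh.
have S0 : 0 < S by exact: lt_le_trans dS.
have S'0 : 0 < S' by exact: lt_le_trans dS'.
have -> : a' / S' - a / S = ((a' - a) + (a / S) * (S - S')) / S'.
  by field; rewrite !gt_eqF.
have aS1 : 0 <= a / S <= 1 by rewrite divr_ge0 ?(ltW S0) //= ler_pdivrMr // mul1r.
have num : `|(a' - a) + (a / S) * (S - S')| <= (n + 1) * h.
  apply: le_trans (ler_normD _ _) _; rewrite normrM (distrC S) ger0_norm; last by case/andP: aS1.
  have := normr_ge0 (S' - S); nra.
rewrite normrM normfV (gtr0_norm S'0) ler_pdivrMr //.
have : (n + 1) * h <= h * ((n + 1) / d) * S'.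
  have -> : h * ((n + 1) / d) * S' = (n + 1) * h * (S' / d) by ring.
  rewrite -[leLHS]mulr1 ler_wpM2l ?mulr_ge0 ?addr_ge0 //.
  by rewrite ler_pdivlMr // mul1r.
exact: le_trans.
Qed.

(** A tent of slope 1; Lipschitz weights suffice because only their differences enter. *)
Definition bump (r : vec -> R) p x : R := Num.max 0 (r p / 2 - `|x - p|).

Lemma bump_ge0 r p x : 0 <= bump r p x.
Proof. by rewrite le_max lexx. Qed.

Lemma bump_neq0 r p x : bump r p x != 0 -> `|x - p| < r p / 2.
Proof.
rewrite /bump -subr_gt0 ltNge => b0; apply/negP => le0.
by move: b0; rewrite (max_l le0) eqxx.
Qed.

Lemma bump_lipschitz r p x y : `|bump r p x - bump r p y| <= `|x - y|.
Proof.
have d1 : `|x - p| <= `|x - y| + `|y - p| by rewrite -(subrKA y) ler_normD.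
have d2 : `|y - p| <= `|x - y| + `|x - p|.
  by rewrite -(subrKA x) (distrC x y) ler_normD.
by rewrite /bump ler_norml; case: (leP 0 (r p / 2 - `|x - p|)) => ?;
  case: (leP 0 (r p / 2 - `|y - p|)) => ?; apply/andP; split;
  have := normr_ge0 (x - y); lra.
Qed.

(** The order of choices matters: the cover fixes the Lipschitz constant [L] of the weights, then
    [eta] and the shift [t] are taken small relative to [L] through the modulus of continuity, and
    [rho] comes last, by compactness. *)
Lemma almost_monogenic B f (eps : R) : open B -> compact (closure B) ->
  (forall p, closure B p -> exists2 e : R, 0 < e & exists2 v, `|v| <= 1 &
    forall x t, 0 < t < e -> closure B x -> `|x - p| < e -> B (x - t *: v)) ->
  Ck_open 1 B f -> {within closure B, continuous f} ->
  (forall x, B x -> Dirac f x = 0) -> 0 < eps ->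
  exists2 rho : R, 0 < rho & exists G : vec -> vec,
    (forall x, B x -> `|G x - f x| <= eps) /\
    (forall y x (h : R), closure B y -> `|x - y| < rho -> 0 < h < rho ->
       `|central_dirac h G x| <= eps).
Proof.
move=> oB cK inw fC fcont Df eps0; set K := closure B.
have BK x : B x -> K x by exact: subset_closure.
have /choice[rv rvP] : forall p, exists rv : R * vec, K p -> 0 < rv.1 /\ `|rv.2| <= 1 /\
    forall x t, 0 < t < rv.1 -> K x -> `|x - p| < rv.1 -> B (x - t *: rv.2).
  move=> p; have [/inw[e e0 [v v1 vB]]|nK] := pselect (K p); first by exists (e, v).
  by exists (0, 0) => /nK.
pose r p := (rv p).1; pose v p := (rv p).2.
(* Quarter balls cover while bumps reach to half the radius, so the sum of the bumps is at least
   [rmin / 8] within that distance of the closure. *)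
have [|s sK scov] := compact_finite_balls (r := fun p => r p / 4) cK.
  by move=> p /rvP[? _]; rewrite divr_gt0.
have r0 p : p \in s -> 0 < r p by move=> /sK/rvP[].
have [|p /r0 rp0|rmin rmin0 rminP] := @seq_uniform R _ s (fun p e => e <= r p).
- by move=> p a b ab /(le_trans ab).
- by exists (r p).
pose n : R := (size s)%:R; have n0 : 0 <= n by [].
pose d := rmin / 8; have d0 : 0 < d by rewrite divr_gt0.
pose L := (n + 1) / d; have L0 : 0 <= L by rewrite divr_ge0 ?addr_ge0 // ltW.
(* Makes the gluing error [512 * n * L * eta] at most [eps / 2]. *)
pose c := 2 * (512 * n * L + 1).
have c1 : 1 <= c.
  by rewrite /c -mulrA; have := mulr_ge0 n0 L0; lra.
pose eta := eps / c.
have eta0 : 0 < eta by rewrite divr_gt0 //; lra.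
have [om om0 omP] := within_uniform cK fcont eta0.
pose t := Num.min rmin om / 4.
have t0 : 0 < t by rewrite divr_gt0 // lt_min rmin0.
have tr : t < rmin by rewrite /t; case: (leP rmin om) => ?; lra.
have tom : t <= om / 4 by rewrite /t; case: (leP rmin om) => ?; lra.
have eps2 : 0 < eps / 2 by rewrite divr_gt0.
(* Wherever the bump at [p] is active, the shifted point has a margin [e] inside [B] and [f] is
   almost discretely monogenic there. *)
pose Q (e : R) x := forall p, p \in s -> `|x - p| < r p / 2 ->
  (forall z, `|z - (x - t *: v p)| < e -> B z) /\
  (forall h, 0 < h < e -> `|central_dirac h f (x - t *: v p)| <= eps / 2).
have [|q Kq|rho rho0 rhoP] := @compact_uniform R K Q cK.
- move=> a b x ab Qb p ps xp; have [b1 b2] := Qb p ps xp; split=> [z za|h /andP[h0 ha]].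
    by apply: b1; exact: lt_le_trans ab.
  by apply: b2; rewrite h0 (lt_le_trans ha).
- have [|p ps|e e0 eP] := @seq_uniform R _ s (fun p e => forall x, `|x - q| < e ->
    `|x - p| < r p / 2 -> (forall z, `|z - (x - t *: v p)| < e -> B z) /\
    (forall h, 0 < h < e -> `|central_dirac h f (x - t *: v p)| <= eps / 2)).
  + move=> p a b ab Qb x xa xp; have [|b1 b2] := Qb x _ xp; first exact: lt_le_trans ab.
    split=> [z za|h /andP[h0 ha]]; first by apply: b1; exact: lt_le_trans ab.
    by apply: b2; rewrite h0 (lt_le_trans ha).
  + have rp := r0 _ ps; have [_ [_ vB]] := rvP _ (sK _ ps).
    (* If [q] is at least [r p] away from [p], the bump at [p] is inactive near [q]. *)
    have [qp|qp] := ltP `|q - p| (r p); last first.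
      exists (r p / 2); first by rewrite divr_gt0.
      move=> x xq xp; have : `|q - p| <= `|x - q| + `|x - p|.
        by rewrite -(subrKA x) (distrC x q) ler_normD.
      lra.
    have Bq : B (q - t *: v p).
      by apply: vB => //; rewrite t0 (lt_le_trans tr) // rminP.
    have [e1 e10 e1B] := open_vecP oB Bq.
    have [e2 e20 e2P] := central_dirac_small oB fC Bq (Df _ Bq) eps2.
    exists (Num.min (e1 / 2) e2); first by rewrite lt_min divr_gt0.
    have eqx x : x - t *: v p - (q - t *: v p) = x - q.
      by rewrite opprB addrA subrK.
    move=> x; rewrite lt_min => /andP[x1 x2] _; split=> [z|h].
      rewrite lt_min => /andP[z1 _]; apply: e1B.
      rewrite -(subrKA (x - t *: v p)) eqx; apply: le_lt_trans (ler_normD _ _) _; lra.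
    by rewrite lt_min => /andP[h0 /andP[_ h2]]; apply: e2P; rewrite ?eqx ?h0.
  by exists e => // x xq p ps xp; exact: eP.
pose S x := \sum_(p <- s) bump r p x; pose chi p x := bump r p x / S x.
(* The extra halving is for stencil points, which lie within [2 * rho'] of [y]. *)
pose rho' := Num.min (rho / 2) (Num.min (d / 2) (om / 4)).
have rho'0 : 0 < rho' by rewrite !lt_min !divr_gt0.
have [rho'1 [rho'2 rho'3]] : rho' <= rho / 2 /\ rho' <= d / 2 /\ rho' <= om / 4.
  by rewrite /rho'; split; [|split]; rewrite !ge_min lexx ?orbT.
have Sd y x : K y -> `|x - y| <= d -> d <= S x.
  move=> /scov[p ps yp] xy; have rp := rminP _ ps.
  have xp : `|x - p| <= `|x - y| + `|y - p| by rewrite -(subrKA y) ler_normD.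
  rewrite /S big_seq (big_rem p) //= ps.
  apply: (@le_trans _ _ (bump r p x)).
    by rewrite /bump le_max; apply/orP; right; rewrite /d in xy *; lra.
  by rewrite lerDl; apply: sumr_ge0 => ? _; exact: bump_ge0.
have bS p x : p \in s -> 0 <= bump r p x <= S x.
  move=> ps; rewrite bump_ge0 /S (big_rem p) //= lerDl.
  by apply: sumr_ge0 => ? _; exact: bump_ge0.
have chi1 y x : K y -> `|x - y| <= d -> \sum_(p <- s) chi p x = 1.
  move=> Ky /(Sd _ _ Ky) dS; rewrite /chi -mulr_suml divff // gt_eqF //.
  exact: lt_le_trans dS.
have chi_ge0 p x : p \in s -> 0 <= chi p x.
  move=> /(bS p x)/andP[b0 bS1]; apply: divr_ge0 => //; exact: le_trans bS1.
pose g p x := f (x - t *: v p).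
have gclose y x p : K y -> p \in s -> B (x - t *: v p) -> `|x - y| < om / 2 ->
    `|g p x - f y| <= eta.
  move=> Ky ps /BK Bx xy; apply: omP => //; have [_ [v1 _]] := rvP _ (sK _ ps).
  rewrite addrAC; apply: le_lt_trans (ler_normB _ _) _.
  rewrite normrZ gtr0_norm //; have : t * `|v p| <= t * 1 by rewrite ler_pM2l.
  lra.
exists rho' => //; exists (fun x => \sum_(p <- s) chi p x *: g p x); split.
  move=> x Bx; have Kx := BK _ Bx.
  have s1 : \sum_(p <- s) chi p x = 1 by apply: (chi1 x) => //; rewrite subrr normr0 ltW.
  have -> : \sum_(p <- s) chi p x *: g p x - f x = \sum_(p <- s) chi p x *: (g p x - f x).
    rewrite -{1}[f x]scale1r -s1 scaler_suml -sumrB.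
    by apply: eq_bigr => p _; rewrite scalerBr.
  apply: le_trans (ler_norm_sum _ _ _) _.
  have : eta <= eps by rewrite /eta ler_pdivrMr; nra.
  apply: le_trans; rewrite -[leRHS]mul1r -s1 mulr_suml big_seq [leRHS]big_seq.
  apply: ler_sum => p ps; rewrite normrZ ger0_norm ?chi_ge0 //.
  have [->|c0] := eqVneq (chi p x) 0; first by rewrite !mul0r.
  rewrite ler_wpM2l ?chi_ge0 //; apply: gclose => //; last first.
    by rewrite subrr normr0 divr_gt0.
  have bp : bump r p x != 0 by apply: contra_neq c0 => b0; rewrite /chi b0 mul0r.
  have [|Bz _] := rhoP x x Kx _ p ps (bump_neq0 bp); first by rewrite subrr normr0.
  by apply: Bz; rewrite subrr normr0.
move=> y x h Ky xy /andP[h0 hrho].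
have hl (l : 'I_8) : `|h *: evec R l| <= h.
  by rewrite normrZ gtr0_norm // -[leRHS]mulr1 ler_pM2l // norm_evec.
have stencil x' : `|x' - x| <= h -> `|x' - y| < 2 * rho'.
  by move=> x'x; rewrite -(subrKA x); apply: le_lt_trans (ler_normD _ _) _; lra.
have sum1 x' : `|x' - x| <= h -> \sum_(p <- s) chi p x' = 1.
  by move=> /stencil x'y; apply: (chi1 y) => //; lra.
have osc p x' : p \in s -> `|x' - x| <= h ->
    `|(chi p x' - chi p x) *: (g p x' - f y)| <= h * (L * eta).
  move=> ps x'x; have x'y := stencil _ x'x.
  (* If both bumps vanish, the product is 0 whatever [f] is outside [B]. Otherwise the shifted [x']
     lies in [B], directly or by the margin around the shifted [x]. *)
  have [both0|] := boolP ((bump r p x' == 0) && (bump r p x == 0)).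
    case/andP: both0 => /eqP b1 /eqP b2.
    rewrite /chi b1 b2 !mul0r subrr scale0r normr0.
    exact: mulr_ge0 (ltW h0) (mulr_ge0 L0 (ltW eta0)).
  rewrite negb_and => act; have Bx' : B (x' - t *: v p).
    case/orP: act => /bump_neq0 bp.
      have [|Bz _] := rhoP y x' Ky _ p ps bp; first by lra.
      by apply: Bz; rewrite subrr normr0.
    have [|Bz _] := rhoP y x Ky _ p ps bp; first by lra.
    by apply: Bz; rewrite opprB addrA subrK; lra.
  rewrite normrZ mulrA; apply: ler_pM => //; last by apply: gclose => //; lra.
  apply: normalized_lipschitz => //.
  - by apply: (Sd y) => //; lra.
  - by apply: (Sd y) => //; lra.
  - exact: bS.
  - exact: ltW.
  - exact: le_trans (bump_lipschitz _ _ _ _) x'x.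
  - rewrite /S -sumrB; apply: le_trans (ler_norm_sum _ _ _) _.
    have -> : n * h = \sum_(p <- s) h.
      by rewrite big_const_seq count_predT iter_addr addr0 mulr_natl.
    by apply: ler_sum => q _; exact: le_trans (bump_lipschitz _ _ _ _) x'x.
have xpl (l : 'I_8) : `|x + h *: evec R l - x| <= h by rewrite addrAC subrr add0r.
have xml (l : 'I_8) : `|x - h *: evec R l - x| <= h by rewrite addrAC subrr add0r normrN.
have := @central_dirac_glue s chi g x (f y) h (eps / 2) (L * eta) h0 (ltW eps2).
have Le : 512 * n * (L * eta) <= eps / 2.
  have -> : 512 * n * (L * eta) = 512 * (n * L) * eps / c by rewrite /eta; ring.
  rewrite ler_pdivrMr; last by lra.
  by rewrite /c -mulrA; move: eps0; clear; lra.
move=> /(_ (mulr_ge0 L0 (ltW eta0))) glue.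
apply: (@le_trans _ _ (eps / 2 + 512 * n * (L * eta))); last by lra.
apply: glue.
- by apply: sum1; rewrite subrr normr0 ltW.
- by move=> l; split; exact: sum1.
- by move=> p /chi_ge0.
- move=> p ps c0; have bp : bump r p x != 0.
    by apply: contra_neq c0 => b0; rewrite /chi b0 mul0r.
  have [|_ /(_ h)] := rhoP y x Ky _ p ps (bump_neq0 bp); first by lra.
  have -> : central_dirac h (g p) x = central_dirac h f (x - t *: v p).
    by apply: eq_bigr => l _; rewrite /g (addrAC x (h *: evec R l)) (addrAC x (- (h *: evec R l))).
  by apply; rewrite h0; lra.
- by move=> p l ps; split; exact: osc.
Qed.

End PartitionOfUnity.

(** * Correction to exact discrete solutions and choice of one family *)

Section Assembly.
Variable R : realType.
Local Notation vec := 'rV[R]_8.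
Local Notation lattice := 'rV[int]_8.
Implicit Types (B : set vec) (f : vec -> vec) (k : lattice).

Lemma norm_le_enorm (x : vec) : `|x| <= enorm x.
Proof.
apply: mx_norm_le => [|i c]; first exact: sqrtr_ge0.
rewrite ord1 -sqrtr_sqr /enorm ler_wsqrtr // (bigD1 c) //= lerDl.
by apply: sumr_ge0 => j _; exact: sqr_ge0.
Qed.

Lemma emb_addiv (h : R) k l : emb h (k + ivec l) = emb h k + h *: evec R l.
Proof.
by apply/rowP => i; rewrite !mxE /= -mulrDr rmorphD /= rmorph_nat.
Qed.

Lemma emb_subiv (h : R) k l : emb h (k - ivec l) = emb h k - h *: evec R l.
Proof.
by apply/rowP => i; rewrite !mxE /= -mulrBr rmorphB /= rmorph_nat.
Qed.

Lemma Dh_emb (h : R) (G : vec -> vec) k :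
  Dh h (fun x => G (emb h x)) k = central_dirac h G (emb h k).
Proof. by apply: eq_bigr => l _; rewrite emb_addiv emb_subiv. Qed.

Lemma Dh0 (h : R) k : Dh h (fun=> 0 : vec) k = 0.
Proof. by rewrite /Dh big1 // => l _; rewrite subrr scaler0 omul0r. Qed.

Lemma emb_box (h r : R) (N : nat) k : 0 < h -> r < h * N%:R -> `|emb h k| <= r -> box N k.
Proof.
move=> h0 rN kr i; have := le_trans (mx_norm_coord _ 0 i) kr.
rewrite !mxE normrM gtr0_norm // -intr_norm => /le_lt_trans/(_ rN).
by rewrite ltr_pM2l // pmulrn ltr_int => /ltW.
Qed.

Lemma bounded_closure B : bounded_set B ->
  exists2 M : R, 0 < M & forall x, closure B x -> `|x| <= M.
Proof.
move=> [M [_ BM]]; exists (`|M| + 2); first by have := normr_ge0 M; lra.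
move=> x /closure_vecP/(_ 1 ltr01)[y By yx].
have yM : `|y| <= `|M| + 1 by apply: BM => //; have := ler_norm M; lra.
by rewrite -(subrK y x); apply: le_trans (ler_normD _ _) _; rewrite distrC; lra.
Qed.

(** The restriction of [G] is corrected by a small [u] having the same [Dh] on the discrete
    interior. *)
Lemma discrete_monogenic_approx B (Bh : R -> set lattice) f (eps : R) :
  bounded_domain B -> C3_boundary B -> lattice_converges Bh B ->
  Ck_open 1 B f -> {within closure B, continuous f} ->
  (forall x, B x -> Dirac f x = 0) -> 0 < eps ->
  exists2 h0 : R, 0 < h0 & forall h : R, 0 < h -> h < h0 ->
    exists F : lattice -> vec, (forall k, dint (Bh h) k -> Dh h F k = 0) /\
      forall k, Bh h k -> B (emb h k) -> enorm (f (emb h k) - F k) <= eps.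
Proof.
move=> [_ [oB [_ bB]]] C3 conv fC fc Df eps0.
have [M M0 BM] := bounded_closure bB.
have cK : compact (closure B).
  apply: bounded_closed_compact; last exact: closed_closure.
  exists M; split; first exact: num_real.
  by move=> M' MM' x /BM /le_trans; apply; exact: ltW.
have [C C0 solve] := Dh_solve R.
(* Gives [C * (M + 2) * eta = eps / 16]; 16 pays for two errors and the factor 8 of [enorm_le]. *)
pose c := 16 * C * (M + 2).
have c0 : 0 < c by rewrite !mulr_gt0 //; lra.
pose eta := eps / c; have eta0 : 0 < eta by rewrite divr_gt0.
have e0 : 0 < Num.min eta (eps / 16) by rewrite lt_min eta0 divr_gt0.
have inw p : closure B p -> exists2 e : R, 0 < e & exists2 v, `|v| <= 1 &
    forall x t, 0 < t < e -> closure B x -> `|x - p| < e -> B (x - t *: v).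
  exact: C3_boundary_inward.
have [rho rho0 [G [Gf DG]]] := almost_monogenic oB cK inw fC fc Df e0.
pose a := Num.min (rho / 2) 1; have a0 : 0 < a by rewrite lt_min divr_gt0 ?ltr01.
have [a1 a2] : a <= rho / 2 /\ a <= 1 by rewrite !ge_min !lexx orbT.
have [h1 [h10 hconv]] := conv _ a0.
exists (Num.min h1 a); first by rewrite lt_min h10.
move=> h h0; rewrite lt_min => /andP[hh1 ha].
have [_ [_ [_ near]]] := hconv _ h0 hh1.
have near1 k : Bh h k -> exists2 y, closure B y & `|emb h k - y| <= a.
  by move=> /near[y [Ky ky]]; exists y => //; exact: le_trans (norm_le_enorm _) ky.
(* Then [M + 1 < h * N <= M + 2], using [h < 1]: [box N] contains [Bh h] and its physical size is
   bounded. *)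
pose N := (Num.truncn ((M + 1) / h)).+1.
have /andP[N1 N2] : (Num.truncn ((M + 1) / h))%:R <= (M + 1) / h < N%:R.
  by apply: truncn_itv; rewrite divr_ge0 //; lra.
have hN : M + 1 < h * N%:R by move: N2; rewrite ltr_pdivrMr // mulrC.
have hN2 : h * N%:R <= M + 2.
  move: N1; rewrite ler_pdivlMr // /N -natr1 mulrDr mulr1 mulrC; lra.
have Bbox k : Bh h k -> box N k.
  move=> /near1[y /BM yM ky]; apply: (emb_box h0 hN).
  by rewrite -(subrK y (emb h k)); apply: le_trans (ler_normD _ _) _; lra.
(* Cut off, because [Dh] of [G] is controlled only near the closure of [B]. *)
pose g k := if `[< dint (Bh h) k >] then Dh h (fun x => G (emb h x)) k else 0.
have gb k : box (2 * N) k -> `|g k| <= eta.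
  move=> _; rewrite /g; case: asboolP => [[Bk _]|_]; last by rewrite normr0 ltW.
  have [y Ky ky] := near1 _ Bk; rewrite Dh_emb.
  apply: le_trans (DG y _ h Ky _ _) _; [lra| |by rewrite ge_min lexx].
  by rewrite h0 /=; lra.
have [u [Du ub]] := solve h eta N g h0 eta0 (ltn0Sn _) gb.
exists (fun k => G (emb h k) - u k); split=> [k dk|k Bk Bx].
  rewrite DhB Du; last by apply: (@box_le N); [exact: leq_pmull|apply: Bbox; case: dk].
  by rewrite /g asboolT // subrr.
have u1 : `|u k| <= eps / 16.
  apply: le_trans (ub _ (Bbox _ Bk)) _.
  apply: (@le_trans _ _ (C * (M + 2) * eta)).
    by rewrite ler_wpM2r ?(ltW eta0) // ler_wpM2l // ltW.
  by rewrite /eta /c le_eqVlt; apply/orP; left; apply/eqP; field; rewrite !gt_eqF //; lra.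
have u2 : `|G (emb h k) - f (emb h k)| <= eps / 16.
  by apply: le_trans (Gf _ Bx) _; rewrite ge_min lexx orbT.
apply: le_trans (enorm_le _) _; rewrite opprB addrCA addrC.
have := ler_normB (u k) (G (emb h k) - f (emb h k)).
rewrite opprB [f _ - _ + _]addrC; lra.
Qed.

(** One [F] must serve all precisions at once: keep a witness for the finest attainable
    [1 / (n + 1)] with [n <= m]; it also attains the coarser ones. *)
Lemma diagonal_choice (T : Type) (P : T -> Prop) (E : R -> T -> Prop) :
  (forall a b F, a <= b -> E a F -> E b F) -> (exists F, P F) -> forall m : nat,
  exists F, P F /\ forall n, (n <= m)%N ->
    (exists2 F', P F' & E n.+1%:R^-1 F') -> E n.+1%:R^-1 F.
Proof.
move=> Em [F0 PF0]; elim=> [|m [F [PF EF]]].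
  have [[F PF EF]|nE] := pselect (exists2 F, P F & E 1%:R^-1 F).
    by exists F; split=> // n; rewrite leqn0 => /eqP ->.
  by exists F0; split=> // n; rewrite leqn0 => /eqP -> /nE.
have [[F' PF' EF']|nE] := pselect (exists2 F, P F & E m.+2%:R^-1 F).
  exists F'; split=> // n nm _; apply: Em EF'.
  by rewrite lef_pV2 ?posrE ?ltr0n // ler_nat ltnS.
exists F; split=> // n; rewrite leq_eqVlt => /orP[/eqP -> /nE //|]; exact: EF.
Qed.

End Assembly.

Theorem mainTheorem18 (R : realType) (B : set 'rV[R]_8)
  (Bh : R -> set 'rV[int]_8) (f : 'rV[R]_8 -> 'rV[R]_8) :
  bounded_domain B -> C3_boundary B -> approx_O_h2 Bh B ->
  Ck_closure 3 B f -> (forall x, B x -> Dirac f x = 0) ->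
  exists F : R -> 'rV[int]_8 -> 'rV[R]_8,
    (forall h : R, 0 < h -> forall k, dint (Bh h) k -> Dh h (F h) k = 0) /\
    (forall eps : R, 0 < eps -> exists h0 : R, 0 < h0 /\
       forall h : R, 0 < h -> h < h0 ->
         forall k, Bh h k -> B (emb h k) -> enorm (f (emb h k) - F h k) <= eps).
Proof.
move=> bB C3 [conv _] [fC [fc _]] Df.
have fC1 : Ck_open 1 B f.
  move=> s s1; have [c d] := fC s (leq_trans s1 (isT : (1 <= 3)%N)); split=> // s0 l x Bx.
  by apply: d => //; exact: leq_trans s0 (isT : (1 <= 3)%N).
pose P h F := forall k, dint (Bh h) k -> Dh h F k = 0.
pose E h e F := forall k, Bh h k -> B (emb h k) -> enorm (f (emb h k) - F k) <= e.
(* The range of precisions grows like [1 / h], so each fixed one is eventually included as [h] tends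
   to 0. *)
have /choice[F FP] h : exists F, P h F /\ forall n, (n <= Num.truncn h^-1)%N ->
    (exists2 F', P h F' & E h n.+1%:R^-1 F') -> E h n.+1%:R^-1 F.
  apply: diagonal_choice => [a b F ab Ea k Bk Bx|].
    exact: le_trans (Ea _ Bk Bx) ab.
  by exists (fun=> 0) => k _; exact: Dh0.
exists F; split=> [h _|eps eps0]; first exact: (FP h).1.
pose n := Num.truncn eps^-1.
have n0 : 0 < n.+1%:R^-1 :> R by rewrite invr_gt0 ltr0n.
have [h1 h10 h1P] := discrete_monogenic_approx bB C3 conv fC1 fc Df n0.
exists (Num.min h1 n.+1%:R^-1); split; first by rewrite lt_min h10.
move=> h h0; rewrite lt_min => /andP[hh1 hn] k Bk Bx.
have [F' [PF' EF']] := h1P _ h0 hh1.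
apply: (@le_trans _ _ n.+1%:R^-1).
  apply: (FP h).2 => //; last by exists F'.
  rewrite truncn_ge_nat ?invr_ge0 ?(ltW h0) //.
  apply: (@le_trans _ _ n.+1%:R); first by rewrite ler_nat.
  by rewrite -[leLHS]invrK lef_pV2 ?posrE ?invr_gt0 ?ltr0n // ltW.
rewrite invf_ple ?posrE ?ltr0n //.
exact: ltW (truncnS_gt _).
Qed.
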